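(* Let $\alpha=(\alpha_n)_{n\ge1}$ be a probability measure on the set of positive integers, let $\lambda=\sum_{n\ge1}\alpha_n\kappa_n$ with $\kappa_n=\mathrm{Unif}(K_n)$, and let $\mu=\delta_{-1}\otimes\lambda$ be the corresponding probability measure on the lamplighter group $\mathcal L=\mathbb Z\wr\mathbb Z_2$. If the entropy $H(\mu)$ is infinite, then the reflected measure $\check\mu$ is non-Liouville, while the measure $\mu$ itself is Liouville.
   Context: Random walks and the Liouville property. For a probability measure $\mu$ on a countable group $G$ (with identity $e$), the random walk $(G,\mu)$ issued from $e$ is $g_t=h_1h_2\cdots h_t$, $g_0=e$, with $(h_t)$ i.i.d. $\mu$-distributed; let $\mathbf P$ be its law on $G^{\mathbb Z_+}$. The measure $\mu$ is called Liouville if the image of $\mathbf P$ on the Poisson boundary is a point mass, i.e. if every subset of $G^{\mathbb Z_+}$ invariant under the time shift $(g_0,g_1,\dots)\mapsto(g_1,g_2,\dots)$ has $\mathbf P$-measure $0$ or $1$. Equivalently, every bounded function $f$ on the set $S=\bigcup_{t\ge0}\operatorname{supp}\mu^{*t}$ of points attainable from $e$ (with $\mu^{*0}=\delta_e$) satisfying $f(g)=\sum_h\mu(h)f(gh)$ for all $g\in S$ is constant. No irreducibility of $\mu$ is assumed. Non-Liouville means not Liouville. The entropy is $H(\mu)=-\sum_g\mu(g)\log\mu(g)\in[0,\infty]$, and the reflected measure is $\check\mu(g)=\mu(g^{-1})$. Group. $\Phi=\bigoplus_{\mathbb Z}\mathbb Z_2$ is the group of finitely supported functions (configurations) $\varphi:\mathbb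 Z\to\mathbb Z_2=\{0,1\}$ under pointwise addition mod 2, with $\operatorname{supp}\varphi=\varphi^{-1}(1)$. The shifts are $(T^n\varphi)(z)=\varphi(z-n)$. The lamplighter group $\mathcal L=\mathbb Z\wr\mathbb Z_2$ is the set $\mathbb Z\times\Phi$ with multiplication $(n_1,\varphi_1)(n_2,\varphi_2)=(n_1+n_2,\varphi_1+T^{n_1}\varphi_2)$. Measures. For $n\ge1$, $K_n=\{\varphi\in\Phi:\operatorname{supp}\varphi\subset\{0,1,\dots,n\},\ \varphi(n)=1\}$ (so $|K_n|=2^n$), and $\kappa_n=\mathrm{Unif}(K_n)$ is the uniform probability measure on $K_n$. The measure $\delta_{-1}\otimes\lambda$ on $\mathcal L=\mathbb Z\times\Phi$ assigns mass $\lambda(\varphi)$ to $(-1,\varphi)$. *)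

(* Defs.v *)
From HB Require Import structures.
From mathcomp Require Import all_boot all_order all_algebra.
From mathcomp Require Import finmap zify.
From mathcomp Require Import all_classical all_reals all_analysis.

Set Implicit Arguments.
Unset Strict Implicit.
Unset Printing Implicit Defensive.

Import Order.TTheory GRing.Theory Num.Theory.

Local Open Scope classical_set_scope.
Local Open Scope ring_scope.

(* Throughout, a probability measure on a countable set T is given by its
   weights p : T -> R. *)

Definition entropy (R : realType) (T : choiceType) (p : T -> R) : \bar R :=
  \esum_(x in [set: T]) (- (p x * ln (p x)))%:E.

Definition unif (R : realType) (T : choiceType) (A : set T) (x : T) : R :=
  \1_A x / (#|` fset_set A|)%:R.

Definition reflected (R : realType) (G : groupType) (mu : G -> R) (g : G) : R :=
  mu (g^-1)%g.

Definition paths (G : groupType) : Type := nat -> G.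

HB.instance Definition _ (G : groupType) := Choice.copy (paths G) (nat -> G).
HB.instance Definition _ (G : groupType) :=
  isPointed.Build (paths G) (fun=> 1%g).

Definition cylinders (G : groupType) : set (set (paths G)) :=
  [set A | exists (t : nat) (x : G), A = [set w | w t = x]].

(* For G countable this is G^nat with the product of the discrete
   sigma-algebras. *)
Notation path_space G := (g_sigma_algebraType (@cylinders G)).

(* The increments h_1, h_2, ... of the walk are indexed from 0, i.e. h t stands
   for h_{t+1}; this says that they are i.i.d. with distribution mu under Q. *)
Definition iid_law (R : realType) (G : groupType) (mu : G -> R)
    (Q : probability (path_space G) R) : Prop :=
  forall (n : nat) (x : nat -> G),
    Q [set h | forall t, (t < n)%N -> h t = x t] =
    (\prod_(t < n) mu (x t))%:E.

Definition walk (G : groupType) (h : paths G) : paths G :=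
  fun t => (\big[*%g/1]_(i < t) h i)%g.

Definition time_shift (G : groupType) (w : paths G) : paths G :=
  fun t => w t.+1.

(* For G countable and mu of total mass 1 there is exactly one Q with
   iid_law mu Q (the product of copies of mu), and A |-> Q (walk @^-1` A) is
   then the law of the random walk (G, mu) issued from the identity. *)
Definition liouville (R : realType) (G : groupType) (mu : G -> R) : Prop :=
  forall Q : probability (path_space G) R, iid_law mu Q ->
  forall A : set (path_space G), measurable A ->
    @time_shift G @^-1` A = A ->
    Q (@walk G @^-1` A) = 0%E \/ Q (@walk G @^-1` A) = 1%E.

Definition config : Type := {fsfun int -> 'Z_2 with 0}.

HB.instance Definition _ := Choice.copy config {fsfun int -> 'Z_2 with 0}.

Definition config_zero : config := [fsfun].

(* - x = x in Z_2. *)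
Definition config_opp (phi : config) : config := phi.

Definition config_add (phi psi : config) : config :=
  [fsfun z in (finsupp phi `|` finsupp psi)%fset => phi z + psi z | 0].

Definition config_shift (n : int) (phi : config) : config :=
  [fsfun z in [fset (y + n)%R | y in finsupp phi]%fset => phi (z - n) | 0].

Lemma configP (phi psi : config) : (forall z, phi z = psi z) -> phi = psi.
Proof. by move=> e; apply/fsfunP. Qed.

Lemma config_zeroE z : config_zero z = 0.
Proof. by rewrite fsfunE. Qed.

Lemma config_addE phi psi z : config_add phi psi z = phi z + psi z.
Proof.
rewrite fsfunE in_fsetU.
by case: ifPn => //; rewrite negb_or => /andP[h1 h2]; rewrite !fsfun_dflt ?addr0.
Qed.

Lemma config_shiftE n phi z : config_shift n phi z = phi (z - n).
Proof.
rewrite fsfunE; case: imfsetP => // hz.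
apply/esym/fsfun_dflt/negP => hzn.
by apply: hz; exists (z - n) => //; rewrite subrK.
Qed.

Fact config_addA : associative config_add.
Proof. by move=> a b c; apply: configP => z; rewrite !config_addE addrA. Qed.

Fact config_addC : commutative config_add.
Proof. by move=> a b; apply: configP => z; rewrite !config_addE addrC. Qed.

Fact config_add0 : left_id config_zero config_add.
Proof. by move=> a; apply: configP => z; rewrite config_addE config_zeroE add0r. Qed.

Fact config_addN : left_inverse config_zero config_opp config_add.
Proof.
move=> a; apply: configP => z; rewrite config_addE config_zeroE /config_opp.
by case: (a z) => -[|[|m]] i //; exact/val_inj.
Qed.

HB.instance Definition _ :=
  GRing.isZmodule.Build config config_addA config_addC config_add0 config_addN.

Lemma configDE (phi psi : config) z : (phi + psi) z = phi z + psi z.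
Proof. exact: config_addE. Qed.

Definition lamplighter : Type := (int * config)%type.

HB.instance Definition _ := Choice.copy lamplighter (int * config)%type.

Definition lamp_one : lamplighter := (0, 0).

Definition lamp_mul (g h : lamplighter) : lamplighter :=
  (g.1 + h.1, g.2 + config_shift g.1 h.2).

Definition lamp_inv (g : lamplighter) : lamplighter :=
  (- g.1, config_shift (- g.1) (- g.2)).

Lemma config_shiftD n phi psi :
  config_shift n (phi + psi) = config_shift n phi + config_shift n psi.
Proof. by apply: configP => z; rewrite config_shiftE !configDE !config_shiftE. Qed.

Lemma config_shift_shift m n phi :
  config_shift m (config_shift n phi) = config_shift (m + n) phi.
Proof.
by apply: configP => z; rewrite !config_shiftE -addrA -opprD.
Qed.

Lemma config_shift0 phi : config_shift 0 phi = phi.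
Proof. by apply: configP => z; rewrite config_shiftE subr0. Qed.

Lemma config_shift_zero n : config_shift n 0 = 0.
Proof. by apply: configP => z; rewrite config_shiftE !config_zeroE. Qed.

Fact lamp_mulA : associative lamp_mul.
Proof.
move=> g h k; rewrite /lamp_mul /=; congr (_, _); first by rewrite addrA.
by rewrite config_shiftD config_shift_shift addrA.
Qed.

Fact lamp_mul1 : left_id lamp_one lamp_mul.
Proof. by move=> [n phi]; rewrite /lamp_mul /= config_shift0 !add0r. Qed.

Fact lamp_mulr1 : right_id lamp_one lamp_mul.
Proof. by move=> [n phi]; rewrite /lamp_mul /= config_shift_zero !addr0. Qed.

Fact lamp_mulV : left_inverse lamp_one lamp_inv lamp_mul.
Proof.
by move=> [n phi]; rewrite /lamp_mul /= -config_shiftD !addNr config_shift_zero.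
Qed.

Fact lamp_mulrV : right_inverse lamp_one lamp_inv lamp_mul.
Proof.
move=> [n phi]; rewrite /lamp_mul /= config_shift_shift !addrN config_shift0.
by rewrite addrN.
Qed.

HB.instance Definition _ :=
  isGroup.Build lamplighter lamp_mulA lamp_mul1 lamp_mulr1 lamp_mulV lamp_mulrV.

Definition K (n : nat) : set config :=
  [set phi : config | (forall z, phi z = 1 -> 0 <= z <= n%:Z) /\ phi n%:Z = 1].

Definition kappa (R : realType) (n : nat) : config -> R := unif R (K n).

Definition lambda (R : realType) (alpha : nat -> R) (phi : config) : R :=
  \big[+%R/0]_(1 <= n <oo) (alpha n * kappa R n phi).

(* The product measure delta_{-1} (x) lambda. *)
Definition mu_of (R : realType) (alpha : nat -> R) (g : lamplighter) : R :=
  (g.1 == -1)%:R * lambda alpha g.2.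

Lemma card_K (n : nat) : finite_set (K n) /\ #|` fset_set (K n)| = (2 ^ n)%N.
Proof.
pose f (u : {ffun 'I_n -> 'Z_2}) : config :=
  [fsfun z in [fset Posz i | i in iota 0 n.+1]%fset =>
    if insub `|z|%N is Some i then u i else 1 | 0].
have fE (u : {ffun 'I_n -> 'Z_2}) (z : int) : f u z =
    if 0 <= z <= n%:Z then (if insub `|z|%N is Some i then u i else 1) else 0.
  rewrite /f fsfunE; congr (if _ then _ else _).
  apply/imfsetP/idP => [[i]|].
    by rewrite inE mem_iota => /= in_ ->; lia.
  case: z => [m|//] /=; rewrite lez_nat => mn.
  by exists m => //; rewrite inE mem_iota; lia.
have fi : injective f.
  move=> u v uv; apply/ffunP => i.
  have fEi w : f w i = w i.
    rewrite fE lez_nat ltnW ?ltn_ord //= (insubT (fun k => k < n)%N (ltn_ord i)).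
    by congr (w _); exact/val_inj.
  by rewrite -!fEi uv.
have KE : K n = [set` [fset f u | u in {: {ffun 'I_n -> 'Z_2}}]%fset].
  apply/seteqP; split=> phi /=.
    move=> [sphi phin]; apply/imfsetP; exists [ffun i : 'I_n => phi (Posz i)].
      by rewrite /= inE.
    apply: configP => z; rewrite fE.
    case: ifPn => [/andP[z0 zn]|zn].
      case: z z0 zn => [m|//] _; rewrite lez_nat /= => mn.
      case: insubP => [i _ im|]; first by rewrite ffunE im.
      by rewrite -leqNgt => nm; rewrite -phin; congr (phi (Posz _)); apply/eqP; rewrite eqn_leq mn.
    have : phi z <> 1 by move/sphi; apply/negP.
    by case: (phi z) => -[|[|m]] i // h; [exact/val_inj|case: h; exact/val_inj].
  move=> /imfsetP[u _ ->]; split.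
    by move=> z; rewrite fE; case: ifP.
  by rewrite fE lexx /= insubF ?ltnn.
split; first by rewrite KE; exact: finite_fset.
by rewrite KE set_fsetK card_imfset //= -cardE card_ffun !card_ord.
Qed.

(* Main.v *)
Require Import Defs.
From mathcomp Require Import all_boot all_order all_algebra.
From mathcomp Require Import finmap zify lra.
From mathcomp Require Import all_classical all_reals all_analysis.
Import Order.TTheory GRing.Theory Num.Theory numFieldNormedType.Exports.
Set Implicit Arguments.
Unset Strict Implicit.
Unset Printing Implicit Defensive.
Local Open Scope classical_set_scope.
Local Open Scope ring_scope.

(** A step of the walk with law mu moves the lighter from x to x - 1 and
    randomizes the lamps at the sites x, ..., x + N - 1 (and switches the lamp at
    x + N), where N is drawn from alpha. Since mu has mass alpha n / 2 ^ n on each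
    of the 2 ^ n elements of level n, its entropy is at most a constant plus twice
    the mean of N (mean_infinite). Infinite entropy therefore means that N has
    infinite mean.

    The measure mu is Liouville. At time t the walk is at - t, and it has changed
    only lamps to the right of - t. Two such configurations at time n differ on
    a finite set of sites, bounded by m, say. A later step at time t with
    N > m + t randomizes all these sites at once, so it can absorb the
    difference. As N has infinite mean, the probabilities of these independent
    events have an infinite sum, and almost surely one of them occurs
    (levels_from_often). This is made into a coupling by an involution of the
    space of increments: at the first suitable step, the difference of the two
    configurations is added to the increment. The involution preserves the law of
    the increments, because it preserves the weight of every prefix
    (swap_preserving), and it takes the walk to the path that starts from
    the other position at time n, up to finitely many times (walk_after_swap).
    Hence an invariant event has the same probability after every prefix, it is
    independent of all prefixes, and so of itself (liouville_swap).

    The reflected measure is not Liouville. Its walk moves to the right and a step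
    from x changes only lamps to the right of x. The lamp at site 1 is thus fixed
    by the first step, for ever (walk_lamp1); its final state is
    an invariant random variable which takes both values with positive probability.
    Since the Liouville property speaks of every law of i.i.d. increments, refuting
    it takes the construction of one: the law of the digits of a uniform point of
    the unit interval, in the expansion with digit frequencies given by the step
    distribution (iid_law_exists). *)

(** * Cylinder sets *)

(** Finite prefixes are encoded as lists, so that the cylinders of all lengths
    form one countable family. *)
Definition cyl (G : groupType) (s : seq G) : set (path_space G) :=
  [set h | mkseq h (size s) = s].

Definition drop_path (G : groupType) (n : nat) (h : path_space G) : path_space G :=
  fun t => h (n + t)%N.

Lemma countable_seq (T : choiceType) :
  countable [set: T] -> countable [set: seq T].
Proof.
move=> /countable_injP[f fi]; apply/countable_injP.
exists (fun s => choice.pickle (map f s)) => s s' _ _ /(pcan_inj choice.pickleK).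
by apply: inj_map => x y; apply: fi; rewrite inE.
Qed.

Lemma cyl_nil (G : groupType) : @cyl G [::] = setT.
Proof. by apply/seteqP; split. Qed.

Lemma cyl1 (G : groupType) (x : G) : cyl [:: x] = [set h | h 0%N = x].
Proof. by apply/seteqP; split=> [h []//|h /= <-]. Qed.

Lemma cyl_mkseq (G : groupType) (h : path_space G) n : cyl (mkseq h n) h.
Proof. by rewrite /cyl/= -/(mkseq h n) size_mkseq. Qed.

Lemma mkseq_eqP (T : Type) (f g : nat -> T) n :
  mkseq f n = mkseq g n <-> forall t, (t < n)%N -> f t = g t.
Proof.
split=> [fg t tn|fg].
  by have /(congr1 (fun s => nth (f t) s t)) := fg; rewrite !nth_mkseq.
apply: (@eq_from_nth _ (f 0)); rewrite !size_mkseq// => i ilt.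
by rewrite !nth_mkseq// fg.
Qed.

Lemma mkseq_take (T : Type) (f : nat -> T) m n : (m <= n)%N ->
  mkseq f m = take m (mkseq f n).
Proof. by move=> mn; rewrite /mkseq -map_take take_iota; congr map; congr iota; lia. Qed.

Lemma measurable_coord (G : groupType) t (x : G) :
  measurable ([set h | h t = x] : set (path_space G)).
Proof. by apply: sub_sigma_algebra; exists t, x. Qed.

Lemma cylE (G : groupType) (s : seq G) (x0 : G) :
  cyl s = \bigcap_(t in `I_(size s)) [set h | h t = nth x0 s t].
Proof.
apply/seteqP; split=> h /=.
  by move=> hs t /= ts; rewrite -hs nth_mkseq.
move=> hs; apply: (@eq_from_nth _ x0); rewrite size_mkseq// => i ilt.
by rewrite nth_mkseq// hs.
Qed.

Lemma measurable_cyl (G : groupType) (s : seq G) : measurable (cyl s).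
Proof.
rewrite (cylE s 1%g); apply: bigcap_measurableType => t _.
exact: measurable_coord.
Qed.
#[local] Hint Resolve measurable_cyl : core.

Definition cyls (G : groupType) : set (set (path_space G)) :=
  [set A | A = set0 \/ exists s, A = cyl s].

(** Two cylinders are nested when one prefix extends the other, and disjoint
    otherwise. *)
Lemma cyls_setI (G : groupType) : setI_closed (@cyls G).
Proof.
have cylI (s s' : seq G) : (size s <= size s')%N -> cyls (cyl s `&` cyl s').
  move=> ss'; have [st|st] := pselect (s = take (size s) s').
    right; exists s'; apply/seteqP; split=> [h []//|h /= hs']; split=> //.
    by rewrite /cyl/= (mkseq_take _ ss') hs' -st.
  left; apply/seteqP; split=> // h [/= hs hs']; apply: st.
  by rewrite -{1}hs -hs' -mkseq_take// size_mkseq.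
move=> _ _ [->|[s ->]] [->|[s' ->]]; rewrite ?set0I ?setI0; try by left.
by have [/cylI//|/ltnW/cylI] := leqP (size s) (size s'); rewrite setIC.
Qed.

(** One coordinate is determined by a prefix, and there are countably many
    prefixes. *)
Lemma measurable_cyls (G : groupType) : countable [set: G] ->
  @measurable _ (path_space G) = <<s @cyls G >>.
Proof.
move=> cG; apply/seteqP; split; last first.
  apply: smallest_sub; first exact: sigma_algebra_measurable.
  by move=> _ [->|[s ->]].
apply: smallest_sub; first exact: smallest_sigma_algebra.
move=> _ [t [x ->]].
rewrite (_ : [set w | w t = x] = \bigcup_(s : seq G)
    (if (size s == t.+1) && (nth x s t == x) then cyl s else set0)).
  apply: (@countable_bigcupT_measurable _ (g_sigma_algebraType (@cyls G))).
    exact: countable_seq.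
  move=> s; case: ifP => _; apply: sub_sigma_algebra; last by left.
  by right; exists s.
apply/seteqP; split=> h /=.
  move=> htx; exists (mkseq h t.+1) => //.
  by rewrite size_mkseq nth_mkseq// htx !eqxx; exact: cyl_mkseq.
move=> [s _]; case: ifP => // /andP[/eqP st /eqP sx] /= hs.
by rewrite -sx -hs nth_mkseq// st.
Qed.

(** The uniqueness principle behind every independence and invariance statement
    below: the cylinders form a generating pi-system. *)
Lemma measure_cyl_unique (R : realType) (G : groupType)
    (m1 m2 : {measure set (path_space G) -> \bar R}) :
  countable [set: G] -> (m1 setT < +oo)%E ->
  (forall s, m1 (cyl s) = m2 (cyl s)) ->
  forall A, measurable A -> m1 A = m2 A.
Proof.
move=> cG m1oo m12; apply: (measure_unique (@cyls G) (fun=> setT)).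
- exact: measurable_cyls.
- exact: cyls_setI.
- by move=> _; right; exists [::]; rewrite cyl_nil.
- by rewrite bigcup_const.
- by move=> _ [->|[s ->]]; rewrite ?measure0.
- by [].
Qed.

Lemma measurable_fun_cyl (d : measure_display) (T : measurableType d)
    (G : groupType) (f : T -> path_space G) :
  countable [set: G] -> (forall s, measurable (f @^-1` cyl s)) ->
  measurable_fun setT f.
Proof.
move=> cG mf; apply: (@measurability _ _ T (path_space G) setT f (@cyls G)).
  exact: measurable_cyls.
move=> _ [_ [->|[s ->]] <-]; rewrite setTI//.
by rewrite preimage_set0.
Qed.

Lemma measurable_fun_paths (d : measure_display) (T : measurableType d)
    (G : groupType) (f : T -> path_space G) :
  (forall t x, measurable [set u | f u t = x]) ->
  measurable_fun setT f.
Proof.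
move=> mf; apply: (@measurability _ _ T (path_space G) setT f (@cylinders G)) => //.
by move=> _ [_ [t [x ->]] <-]; rewrite setTI; exact: mf.
Qed.

Lemma measurable_drop (G : groupType) n :
  measurable_fun setT (@drop_path G n).
Proof.
by apply: measurable_fun_paths => t x; exact: measurable_coord.
Qed.

Lemma measurable_countable_preimage (d : measure_display) (T : measurableType d)
    (U : choiceType) (f : T -> U) (E : set U) :
  countable [set: U] -> (forall x, measurable (f @^-1` [set x])) ->
  measurable (f @^-1` E).
Proof.
move=> cU mf.
rewrite (_ : _ @^-1` _ = \bigcup_(x : U)
    (if x \in E then f @^-1` [set x] else set0)).
  by apply: countable_bigcupT_measurable => // x; case: ifP.
apply/seteqP; split=> u /=.
  by move=> Efu; exists (f u) => //=; rewrite mem_set.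
by move=> [x _]; case: ifPn => //; rewrite inE => Ex /= ->.
Qed.

(** Countable additivity over the fibres of f; it extends identities from single
    values of an increment to arbitrary events of that increment. *)
Lemma measure_eq_countable_preimage (R : realType) (d : measure_display)
    (T : measurableType d) (m1 m2 : {measure set T -> \bar R})
    (U : choiceType) (f : T -> U) (E : set U) :
  countable [set: U] -> (forall x, measurable (f @^-1` [set x])) ->
  (forall x, E x -> m1 (f @^-1` [set x]) = m2 (f @^-1` [set x])) ->
  m1 (f @^-1` E) = m2 (f @^-1` E).
Proof.
move=> cU mf m12.
move: (cU) => /countable_injP[c ci].
pose F k := f @^-1` (E `&` [set x | c x = k]).
have FE : f @^-1` E = \bigcup_k F k.
  apply/seteqP; split=> u /=; first by exists (c (f u)).
  by move=> [k _ []].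
have mF k : measurable (F k) by exact: measurable_countable_preimage.
have tF : trivIset setT F.
  apply/trivIsetP => i j _ _ /eqP ij; apply/seteqP; split=> // u.
  by move=> [[_ /= ui] [_ /= uj]]; apply: ij; rewrite -ui.
rewrite FE !measure_bigcup//; apply: eq_eseriesr => k _.
have [[x [Ex cx]]|nx] := pselect (exists x, E x /\ c x = k).
  suff -> : F k = f @^-1` [set x] by exact: m12.
  apply/seteqP; split=> u /=; last by move=> fux; split; rewrite /= fux.
  by move=> [Ey /=]; rewrite -cx; apply: ci; rewrite inE.
suff -> : F k = set0 by rewrite !measure0.
by apply/seteqP; split=> // u [Ey cy]; apply: nx; exists (f u).
Qed.

(** * Sequences of independent increments *)

Lemma pushforward_agree (R : realType) (G : groupType) (d : measure_display)
    (T : measurableType d) (m : {measure set T -> \bar R})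
    (f : T -> path_space G) (m2 : {measure set (path_space G) -> \bar R}) :
  countable [set: G] -> measurable_fun setT f -> (m setT < +oo)%E ->
  (forall s, m (f @^-1` cyl s) = m2 (cyl s)) ->
  forall A, measurable A -> m (f @^-1` A) = m2 A.
Proof.
move=> cG mf moo mm2.
by apply: (@measure_cyl_unique _ _
  (measure_function_pushforward__canonical__measure_function_Measure m mf)).
Qed.

Section iid.
Context (R : realType) (G : groupType) (cG : countable [set: G]).
Context (mu : G -> R) (Q : probability (path_space G) R).
Hypothesis iidQ : iid_law mu Q.

Lemma iid_cyl s : Q (cyl s) = (\prod_(x <- s) mu x)%:E.
Proof.
rewrite (big_nth 1%g) big_mkord -iidQ.
congr (Q _); apply/seteqP; split=> h.
  by move=> hs t ts; rewrite -[in RHS]hs nth_mkseq.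
move=> hs; apply: (@eq_from_nth _ 1%g); rewrite size_mkseq// => i ilt.
by rewrite nth_mkseq// hs.
Qed.

(** The Markov property at a fixed time: for a fixed prefix both sides are
    finite measures of C, and they agree on cylinders because the weight of a
    concatenation is a product. *)
Lemma iid_cyl_drop s (C : set (path_space G)) : measurable C ->
  Q (cyl s `&` drop_path (size s) @^-1` C) = (Q (cyl s) * Q C)%E.
Proof.
move=> mC.
have r0 : 0 <= \prod_(x <- s) mu x by rewrite -lee_fin -iid_cyl.
have mdrop : measurable_fun setT (@drop_path G (size s)).
  exact: measurable_drop.
have -> : Q (cyl s) = (NngNum r0)%:num%:E by rewrite iid_cyl.
rewrite setIC; change ((mrestr Q (measurable_cyl s)) (drop_path (size s) @^-1` C)
  = mscale (NngNum r0) Q C).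
apply: pushforward_agree => //.
  rewrite /= /mrestr setTI; apply: le_lt_trans (ltry 1).
  by apply: probability_le1; exact: measurable_cyl.
move=> s'; rewrite /= /mrestr /mscale /= !iid_cyl -EFinM -big_cat -iid_cyl.
congr (Q _); apply/seteqP; split=> h /=.
  move=> [hs' hs]; rewrite /cyl /= size_cat; apply: (@eq_from_nth _ 1%g).
    by rewrite size_mkseq size_cat.
  move=> i; rewrite size_mkseq => ilt; rewrite nth_mkseq// nth_cat.
  case: ltnP => si; first by rewrite -[in RHS]hs nth_mkseq.
  rewrite -[in RHS]hs' nth_mkseq; first by rewrite /drop_path subnKC.
  by rewrite ltn_subLR.
rewrite /cyl /= size_cat => hss; split.
  apply: (@eq_from_nth _ 1%g); rewrite size_mkseq// => i ilt.
  have /(congr1 (nth 1%g ^~ (size s + i)%N)) := hss.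
  rewrite !nth_mkseq ?ltn_add2l// nth_cat ltnNge leq_addr/= addKn => <-.
  by [].
apply: (@eq_from_nth _ 1%g); rewrite size_mkseq// => i ilt.
have /(congr1 (nth 1%g ^~ i)) := hss.
by rewrite !nth_mkseq ?ltn_addr// nth_cat ilt.
Qed.

(** The Markov property for an arbitrary event of the first increment. With E
    the whole group it contains the shift-invariance of Q. *)
Lemma iid_head_drop (E : set G) (C : set (path_space G)) : measurable C ->
  Q ((fun h => h 0%N) @^-1` E `&` drop_path 1 @^-1` C) =
  (Q ((fun h => h 0%N) @^-1` E) * Q C)%E.
Proof.
move=> mC.
have mdC : measurable (drop_path 1 @^-1` C : set (path_space G)).
  by rewrite -[X in measurable X]setTI; apply: measurable_drop.
have QCE : Q C = (NngNum (fine_ge0 (measure_ge0 Q C)))%:num%:E.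
  by rewrite /= fineK// fin_num_measure.
rewrite QCE muleC.
change (mrestr Q mdC ((fun h => h 0%N) @^-1` E) =
  mscale (NngNum (fine_ge0 (measure_ge0 Q C))) Q ((fun h => h 0%N) @^-1` E)).
apply: measure_eq_countable_preimage => //.
  by move=> x; exact: measurable_coord.
move=> x _; rewrite /= /mrestr /mscale -QCE.
rewrite -[_ @^-1` [set x]]/[set h : path_space G | h 0%N = x] -cyl1.
by rewrite (iid_cyl_drop [:: x])// muleC.
Qed.

Lemma measurable_drop_preimage n (C : set (path_space G)) : measurable C ->
  measurable (drop_path n @^-1` C : set (path_space G)).
Proof. by move=> mC; rewrite -[X in measurable X]setTI; apply: measurable_drop. Qed.

Lemma iid_drop n (C : set (path_space G)) : measurable C -> Q (drop_path n @^-1` C) = Q C.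
Proof.
move=> mC; elim: n => [|n IH].
  by congr (Q _).
rewrite -IH -[RHS]mul1e -(@probability_setT _ _ _ Q).
rewrite -(preimage_setT (fun h : path_space G => h 0%N)).
rewrite -iid_head_drop; last exact: measurable_drop_preimage.
by rewrite preimage_setT setTI; congr (Q _).
Qed.

Lemma measurable_coord_preimage n (E : set G) :
  measurable ((fun h : path_space G => h n) @^-1` E).
Proof.
by apply: measurable_countable_preimage => // x; exact: measurable_coord.
Qed.

Lemma iid_coord n (E : set G) :
  Q ((fun h => h n) @^-1` E) = Q ((fun h => h 0%N) @^-1` E).
Proof.
rewrite -[RHS](iid_drop n (measurable_coord_preimage _ _)); congr (Q _).
by apply/seteqP; split=> h; rewrite /preimage/= /drop_path addn0.
Qed.

Lemma iid_singleton n x : Q [set h | h n = x] = (mu x)%:E.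
Proof.
rewrite (iid_coord n [set x]) -[_ @^-1` [set x]]/[set h : path_space G | h 0%N = x].
by rewrite -cyl1 iid_cyl big_seq1.
Qed.

Lemma iid_ge0 x : 0 <= mu x.
Proof. by rewrite -lee_fin -(iid_singleton 0). Qed.

(** Independence of finitely many coordinate events, by splitting off the first
    coordinate. *)
Lemma iid_forall n (F : nat -> set G) :
  Q [set h | forall i, (i < n)%N -> F i (h i)] =
  (\prod_(i < n) Q ((fun h => h 0%N) @^-1` F i))%E.
Proof.
elim: n F => [|n IH] F.
  by rewrite big_ord0 -(@probability_setT _ _ _ Q); congr (Q _); apply/seteqP; split.
rewrite big_ord_recl -(IH (fun i => F i.+1)) -iid_head_drop.
  congr (Q _); apply/seteqP; split=> h /=.
    by move=> hF; split=> [|i iln]; rewrite ?/drop_path ?add1n; apply: hF.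
  move=> [h0 hF] [//|i]; rewrite ltnS => /hF.
  by rewrite /drop_path add1n.
rewrite (_ : [set h | _] = \bigcap_(i in `I_n) (fun h => h i) @^-1` F i.+1)//.
by apply: bigcap_measurableType => i _; exact: measurable_coord_preimage.
Qed.

Lemma iid_support :
  Q.-negligible [set h | exists t, mu (h t) = 0].
Proof.
rewrite (_ : [set h | _] = \bigcup_t (fun h => h t) @^-1` [set x | mu x = 0]); last first.
  by apply/seteqP; split=> h /= [t]; exists t.
apply: negligible_bigcup => t; apply/negligibleP.
  exact: measurable_coord_preimage.
apply: (@measure_eq_countable_preimage _ _ _ Q mzero _ (fun h => h t)) => //.
  by move=> x; exact: measurable_coord.
by move=> x /= mux; rewrite iid_singleton mux.
Qed.
End iid.

(** * A coupling criterion for the zero-one law *)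

Lemma walkS (G : groupType) (h : paths G) t : walk h t.+1 = (walk h t * h t)%g.
Proof. by rewrite /walk big_ord_recr. Qed.

Lemma walk_mkseq (G : groupType) (h : paths G) t :
  walk h t = (\big[*%g/1]_(x <- mkseq h t) x)%g.
Proof.
rewrite (big_nth 1%g) size_mkseq big_mkord; apply: eq_bigr => i _.
by rewrite nth_mkseq.
Qed.

Lemma walk_drop (G : groupType) (h : paths G) n t :
  walk h (n + t)%N = (walk h n * walk (drop_path n h) t)%g.
Proof.
elim: t => [|t IH]; first by rewrite addn0 [walk (drop_path _ _) _]big_ord0 mulg1.
by rewrite addnS !walkS IH mulgA.
Qed.

Lemma measurable_prefix (G : groupType) n (E : set (seq G)) :
  countable [set: G] -> measurable ((fun h : path_space G => mkseq h n) @^-1` E).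
Proof.
move=> cG; apply: measurable_countable_preimage; first exact: countable_seq.
move=> s; have [sn|sn] := eqVneq (size s) n.
  rewrite (_ : _ @^-1` _ = cyl s); first exact: measurable_cyl.
  by rewrite /cyl sn.
rewrite (_ : _ @^-1` _ = set0); first exact: measurable0.
apply/seteqP; split=> // h /= hs; move: sn; rewrite -hs size_mkseq.
by rewrite eqxx.
Qed.

Lemma measurable_mul_walk (G : groupType) (g : G) : countable [set: G] ->
  measurable_fun setT
    ((fun h t => g * walk h t)%g : path_space G -> path_space G).
Proof.
move=> cG; apply: measurable_fun_paths => t x.
rewrite (_ : [set u | _] = (fun h : path_space G => mkseq h t) @^-1`
  [set s | (g * \big[*%g/1]_(y <- s) y)%g = x]); first exact: measurable_prefix.
by apply/seteqP; split=> h /=; rewrite walk_mkseq.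
Qed.

Lemma measurable_walk (G : groupType) : countable [set: G] ->
  measurable_fun setT (@walk G : path_space G -> path_space G).
Proof.
move=> cG; rewrite (_ : @walk G = (fun h t => 1 * walk h t)%g).
  exact: measurable_mul_walk.
by apply/funext => h; apply/funext => t; rewrite mul1g.
Qed.

Lemma shift_invariant_drop (G : groupType) (A : set (paths G)) n w :
  @time_shift G @^-1` A = A -> A (drop_path n w) <-> A w.
Proof.
move=> sA; elim: n => [|n IH]; first by rewrite (_ : drop_path 0 w = w).
rewrite -IH -[in X in _ <-> X]sA /=.
rewrite (_ : time_shift _ = drop_path n.+1 w)//.
by apply/funext => t; rewrite /time_shift /drop_path addnS.
Qed.

(** The coupling below makes two paths agree from some time on only; this is
    enough for an invariant event. *)
Lemma shift_invariant_tail (G : groupType) (A : set (paths G)) n w w' :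
  @time_shift G @^-1` A = A -> (forall t, (n <= t)%N -> w t = w' t) ->
  A w <-> A w'.
Proof.
move=> sA ww'; rewrite -(shift_invariant_drop n w sA) -(shift_invariant_drop n w' sA).
rewrite (_ : drop_path n w = drop_path n w')//.
by apply/funext => t; rewrite /drop_path ww'// leq_addr.
Qed.

Lemma measure_eq_negligible (R : realType) (d : measure_display)
    (T : measurableType d) (m : {measure set T -> \bar R}) (X Y N : set T) :
  measurable X -> measurable Y -> m.-negligible N ->
  (forall u, ~ N u -> X u <-> Y u) -> m X = m Y.
Proof.
move=> mX mY [M [mM M0 NM]] XY.
have le (U V : set T) : measurable U -> measurable V ->
    (forall u, ~ N u -> U u -> V u) -> (m U <= m V)%E.
  move=> mU mV UV; apply: (@le_trans _ _ (m (V `|` M))).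
    apply: le_measure; rewrite ?inE//; first exact: measurableU.
    move=> u Uu; have [Nu|Nu] := pselect (N u); first by right; exact: NM.
    by left; exact: UV Uu.
  have : (m (V `|` M) <= m V + m M)%E by exact: measureU2.
  by rewrite M0 adde0.
by apply/eqP; rewrite eq_le !le// => u Nu; have [] := XY u Nu.
Qed.

(** The coupling. Fix a group element g and a time n, and compare the walk with
    the path that sits at g at time n and then follows the same increments as the
    walk. At time t the latter path is offset h * walk h t. Multiplying the
    increment number i on the left by twist h i, the conjugate of the offset by
    the current position, moves the walk onto that path from time i.+1 on. This is
    done once, at the first time at which it leaves the mu-weight of the increment
    unchanged. *)
Section swap.
Context (R : realType) (G : groupType) (mu : G -> R) (g : G) (n : nat).
Implicit Types h : path_space G.

Definition offset h : G := (g * (walk h n)^-1)%g.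

Definition twist h i : G := (offset h ^ walk h i)%g.

(** The offset is required to be an involution, so that performing the swap
    twice restores the increments. *)
Definition swappable h i : Prop :=
  [/\ (n <= i)%N, (offset h * offset h = 1)%g & mu (twist h i * h i)%g = mu (h i)].

Definition first_swap h i : Prop :=
  swappable h i /\ forall j, (j < i)%N -> ~ swappable h j.

Definition swap h : path_space G :=
  fun i => if `[< first_swap h i >] then (twist h i * h i)%g else h i.

Lemma walk_prefix h h' k : (forall t, (t < k)%N -> h t = h' t) ->
  walk h k = walk h' k.
Proof. by move=> hh'; apply: eq_bigr => i _; exact: hh'. Qed.

Lemma twist_prefix h h' i : (n <= i)%N ->
  (forall t, (t < i)%N -> h t = h' t) -> twist h i = twist h' i.
Proof.
move=> ni hh'; rewrite /twist /offset (walk_prefix hh').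
by rewrite (@walk_prefix h h' n)// => t tn; apply: hh'; exact: leq_trans ni.
Qed.

Lemma swappable_prefix h h' i : (forall t, (t < i.+1)%N -> h t = h' t) ->
  swappable h i -> swappable h' i.
Proof.
move=> hh' [ni hh muh]; split=> //.
  rewrite /offset -(@walk_prefix h h' n)// => t tn; apply: hh'.
  by apply: (leq_trans tn); exact: leqW.
by rewrite -(@twist_prefix h h')// ?hh'// -?hh'// => t ti; rewrite hh'// leqW.
Qed.

Lemma first_swap_prefix h h' i : (forall t, (t < i.+1)%N -> h t = h' t) ->
  first_swap h i -> first_swap h' i.
Proof.
move=> hh' [si ni]; split; first exact: swappable_prefix si.
move=> j ji sj; apply: (ni j ji); apply: swappable_prefix sj => t tj.
by rewrite hh'//; lia.
Qed.

(** The swap is causal: the decision at time t and the modified increment depend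
    on the increments up to t only. *)
Lemma swap_prefix h h' k : (forall t, (t < k)%N -> h t = h' t) ->
  forall t, (t < k)%N -> swap h t = swap h' t.
Proof.
move=> hh' t tk; rewrite /swap.
have hht j : (j < t.+1)%N -> h j = h' j by move=> jt; apply: hh'; lia.
have -> : first_swap h t = first_swap h' t.
  apply/propext; split; apply: first_swap_prefix => // j jt.
  by rewrite hht.
case: asboolP => [[[nt _ _] _]|_]; last exact: hh'.
by rewrite (@twist_prefix h h')// ?hh'// => j jt; rewrite hh'//; lia.
Qed.

Lemma first_swap_uniq h i j : first_swap h i -> first_swap h j -> i = j.
Proof.
move=> [si ni] [sj nj]; case: (ltngtP i j) => // ij.
  by have := nj _ ij.
by have := ni _ ij.
Qed.

Lemma swap_before h i : first_swap h i -> forall t, (t < i)%N -> swap h t = h t.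
Proof.
move=> fi t ti; rewrite /swap; case: asboolP => // ft.
by move: ti; rewrite (first_swap_uniq ft fi) ltnn.
Qed.

Lemma swap_at h i : first_swap h i -> swap h i = (twist h i * h i)%g.
Proof. by move=> fi; rewrite /swap; case: asboolP. Qed.

Lemma twist_swap h i : first_swap h i -> twist (swap h) i = twist h i.
Proof.
move=> fi; have [[ni _ _] _] := fi; apply: twist_prefix => //.
exact: swap_before.
Qed.

Lemma twist_invol h i : swappable h i -> (twist h i * twist h i = 1)%g.
Proof.
move=> [_ oo _]; rewrite /twist !conjgE.
move: (offset h) (walk h i) oo => o w oo; rewrite -!mulgA.
by rewrite mulVKg (mulgA o o) oo mul1g mulVg.
Qed.

Lemma first_swap_swap h i : first_swap h i -> first_swap (swap h) i.
Proof.
move=> fi; have [[ni oo muh] nj] := fi; split.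
  split=> //.
    rewrite /offset (@walk_prefix (swap h) h n)// => t tn.
    by apply: (swap_before fi); exact: leq_trans ni.
  have tt : (twist h i * twist h i = 1)%g by apply: twist_invol; split.
  by rewrite twist_swap// swap_at// mulgA tt mul1g muh.
move=> j ji sj; apply: (nj j ji); apply: swappable_prefix sj => t tj.
by apply: (swap_before fi); lia.
Qed.

Lemma first_swap_swapE h i : first_swap (swap h) i -> first_swap h i.
Proof.
move=> fi; have [[j [ji fj]]|nj] := pselect (exists j, (j < i)%N /\ first_swap h j).
  by move: ji; rewrite (first_swap_uniq fi (first_swap_swap fj)) ltnn.
have [//|nfi] := pselect (first_swap h i).
apply: first_swap_prefix fi => t; rewrite ltnS leq_eqVlt => /predU1P[->|ti].
  by rewrite /swap; case: asboolP.
by rewrite /swap; case: asboolP => // ft; case: nj; exists t.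
Qed.

(** The swap does not alter the time at which it takes place, since the weight
    condition is symmetric in an increment and its modification. *)
Lemma swapK : involutive swap.
Proof.
move=> h; apply/funext => i; rewrite {1}/swap; case: asboolP => [fi|nfi].
  have fhi := first_swap_swapE fi.
  by rewrite twist_swap// swap_at// mulgA twist_invol ?mul1g//; case: fhi.
by rewrite /swap; case: asboolP => // /first_swap_swap.
Qed.

Lemma swap_weight h i : mu (swap h i) = mu (h i).
Proof. by rewrite /swap; case: asboolP => // -[[]]. Qed.

(** Being causal and involutive, the swap permutes the prefixes of each length,
    and hence the cylinders. *)
Lemma swap_cyl s : swap @^-1` cyl s = cyl (mkseq (swap (nth 1%g s)) (size s)).
Proof.
(* Any path extending s would do in place of nth 1 s, by causality. *)
have xs : cyl s (nth 1%g s) by exact: mkseq_nth.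
apply/seteqP; split=> h; rewrite /cyl /= size_mkseq => hs.
  apply/mkseq_eqP => t ts; rewrite -[h]swapK; apply: swap_prefix ts.
  by apply/mkseq_eqP; rewrite hs.
rewrite -[RHS]xs; apply/mkseq_eqP => t ts; rewrite -[nth 1%g s]swapK.
by apply: swap_prefix ts; apply/mkseq_eqP.
Qed.

Lemma walk_after_swap h i t : first_swap h i -> (i < t)%N ->
  walk (swap h) t = (offset h * walk h t)%g.
Proof.
move=> fi it; rewrite -(subnKC it); elim: (t - i.+1)%N => [|k IH].
  rewrite addn0 !walkS swap_at// (walk_prefix (swap_before fi)).
  by rewrite /twist conjgE; move: (offset h) => o; rewrite -!mulgA mulVKg.
rewrite addnS [LHS]walkS IH [in RHS]walkS [RHS]mulgA; congr (_ * _)%g.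
rewrite /swap; case: asboolP => // fk; have := first_swap_uniq fk fi; lia.
Qed.

Lemma offset_walk h t : (offset h * walk h (n + t))%g = (g * walk (drop_path n h) t)%g.
Proof. by rewrite walk_drop /offset -mulgA mulKg. Qed.

Section swap_measure.
Hypothesis cG : countable [set: G].
Context (Q : probability (path_space G) R).
Hypothesis iidQ : iid_law mu Q.

Lemma measurable_swap : measurable_fun setT swap.
Proof.
by apply: measurable_fun_cyl => // s; rewrite swap_cyl; exact: measurable_cyl.
Qed.

(** The permutation of prefixes preserves each weight factor by factor. *)
Lemma swap_preserving (A : set (path_space G)) : measurable A ->
  Q (swap @^-1` A) = Q A.
Proof.
move: A; apply: pushforward_agree => //; first exact: measurable_swap.
  by apply: le_lt_trans (ltry 1); exact: probability_le1.
move=> s; rewrite /= swap_cyl !(iid_cyl iidQ); congr (_%:E).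
rewrite !(big_nth 1%g) size_mkseq !big_mkord; apply: eq_bigr => i _.
by rewrite nth_mkseq// swap_weight.
Qed.

End swap_measure.
End swap.

(** If from every attainable position the coupling almost surely succeeds, then
    an invariant event is independent of every finite prefix, because the chance
    of the event after a prefix s does not depend on the position that s leads to.
    An event independent of all prefixes is independent of itself, so that its
    probability is 0 or 1. *)
Lemma liouville_swap (R : realType) (G : groupType) (mu : G -> R) :
  countable [set: G] ->
  (forall Q : probability (path_space G) R, iid_law mu Q ->
    forall s : seq G, (forall x, x \in s -> 0 < mu x) ->
    Q.-negligible [set h | forall i,
      ~ swappable mu (\big[*%g/1]_(x <- s) x)%g (size s) h i]) ->
  liouville mu.
Proof.
move=> cG swapmu Q iidQ A mA sA.
set B : set (path_space G) := @walk G @^-1` A.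
have mB : measurable B by rewrite -[B]setTI; exact: (measurable_walk cG).
have indep s : Q (cyl s `&` B) = (Q (cyl s) * Q B)%E.
  have [s0|s0] := pselect (forall x, x \in s -> 0 < mu x); last first.
    have Qs0 : Q (cyl s) = 0%E.
      rewrite (iid_cyl iidQ); congr (_%:E); apply/eqP; rewrite prodf_seq_eq0.
      apply/hasP; apply: contra_notP s0 => ns x xs.
      rewrite lt_neqAle (iid_ge0 cG iidQ) andbT eq_sym; apply/negP => /= mux.
      by apply: ns; exists x.
    rewrite Qs0 mul0e; apply/eqP; rewrite eq_le measure_ge0 andbT -Qs0.
    have mcyl := measurable_cyl s.
    by apply: le_measure; rewrite ?inE//; exact: measurableI.
  set g := (\big[*%g/1]_(x <- s) x)%g.
  set C := [set h : path_space G | A (fun t => g * walk h t)%g].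
  have mC : measurable C.
    by rewrite -[C]setTI; exact: (measurable_mul_walk g cG).
  have -> : cyl s `&` B = cyl s `&` drop_path (size s) @^-1` C.
    apply/seteqP; split=> h /= [hs] Bh; split=> //; move: Bh.
      move/(shift_invariant_drop (size s) _ sA).2 => /=.
      rewrite /C /=; apply: iffLR; apply: (shift_invariant_tail (n := 0) sA) => t _.
      by rewrite /drop_path walk_drop (walk_mkseq h (size s)) hs.
    move=> Ch; apply/(shift_invariant_drop (size s) _ sA).1; move: Ch => /=.
    rewrite /C /=; apply: iffLR; apply: (shift_invariant_tail (n := 0) sA) => t _.
    by rewrite /drop_path walk_drop (walk_mkseq h (size s)) hs.
  (* Both sides are now brought to the same time, size s: on the left the walk is
     restarted at g, on the right it continues from its own random position. *)
  rewrite (iid_cyl_drop cG iidQ)//; congr (_ * _)%E.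
  rewrite -(iid_drop cG iidQ (size s) mC).
  rewrite -[RHS](swap_preserving g (size s) cG iidQ mB).
  apply: (measure_eq_negligible _ _ (swapmu Q iidQ s s0)).
  - exact: measurable_drop_preimage.
  - by rewrite -[_ @^-1` _]setTI; exact: measurable_swap.
  move=> h /= nh.
  have [i fi] : exists i, first_swap mu g (size s) h i.
    have /existsNP[i /contrapT si] := nh.
    have ex : exists i, `[< swappable mu g (size s) h i >].
      by exists i; apply/asboolP.
    exists (ex_minn ex); case: ex_minnP => m /asboolP sm mm; split=> // j jm.
    by move=> /asboolP /mm; rewrite leqNgt jm.
  rewrite /C /B /=.
  rewrite -[X in _ <-> X](shift_invariant_drop (size s) _ sA).
  apply: (shift_invariant_tail (n := i.+1) sA) => t it.
  by rewrite /drop_path (walk_after_swap fi) ?offset_walk//; lia.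
have QB : Q (B `&` B) = (Q B * Q B)%E.
  have b0 := fine_ge0 (measure_ge0 Q B).
  have QBE : Q B = (NngNum b0)%:num%:E by rewrite /= fineK// fin_num_measure.
  rewrite [X in (X * _)%E]QBE.
  apply: (@measure_cyl_unique _ _ (mrestr Q mB) (mscale (NngNum b0) Q)) => //.
    rewrite /= /mrestr setTI; apply: le_lt_trans (ltry 1).
    exact: probability_le1.
  by move=> s; rewrite /= /mrestr /mscale /= -[X in (X * _)%E]QBE indep muleC.
move: QB; rewrite setIid.
have Bfin : Q B \is a fin_num by rewrite fin_num_measure.
rewrite -(fineK Bfin) -EFinM => -[] /esym/eqP.
rewrite -subr_eq0 -{3}[fine _]mulr1 -mulrBr mulf_eq0 subr_eq0.
by move=> /orP[] /eqP ->; [left|right].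
Qed.

(** * Existence of the law of the increments *)

(** The base-q expansion of a point u of the unit interval: its first digit is
    the index k of the interval between cumul k and cumul k.+1 that contains u,
    and the other digits are those of the affine rescaling of that interval to the
    unit interval. *)
Section digits.
Context (R : realType) (q : nat -> R).
Hypothesis q0 : forall k, 0 <= q k.
Hypothesis q1 : (\sum_(0 <= k <oo) (q k)%:E = 1)%E.

Definition cumul k : R := \sum_(0 <= i < k) q i.

Lemma cumulS k : cumul k.+1 = cumul k + q k.
Proof. by rewrite /cumul big_nat_recr. Qed.

Lemma cumul_le1 k : cumul k <= 1.
Proof.
rewrite -lee_fin -q1 /cumul -sumEFin.
by apply: nneseries_lim_ge => i _; rewrite lee_fin.
Qed.

Lemma cumul_ge0 k : 0 <= cumul k.
Proof. exact: sumr_ge0. Qed.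

Lemma cumul_nd : {homo cumul : j k / (j <= k)%N >-> j <= k}.
Proof.
by apply: homo_leq => [//|? ? ?|k]; [exact: le_trans|rewrite cumulS lerDl].
Qed.

Lemma cumul_sup (u : R) : u < 1 -> exists k, u < cumul k.+1.
Proof.
move=> u1; apply: contrapT => nu.
suff : (1 <= u%:E)%E by rewrite lee_fin leNgt u1.
rewrite -q1; apply: lime_le; first by apply: is_cvg_nneseries => k _ _; rewrite lee_fin.
apply: nearW => k; rewrite sumEFin lee_fin leNgt; apply/negP => uk.
apply: nu; exists k; apply: (lt_le_trans uk); exact: cumul_nd.
Qed.

(** The default value is never taken in the unit interval. *)
Definition digit (u : R) : nat :=
  if pselect (exists k, u < cumul k.+1) is left e then ex_minn e else 0%N.

Definition rescale (u : R) : R := (u - cumul (digit u)) / q (digit u).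

Definition digits (u : R) : nat -> nat := fun t => digit (iter t rescale u).

Lemma digitE u k : 0 <= u < 1 ->
  digit u = k <-> cumul k <= u < cumul k.+1.
Proof.
move=> /andP[u0 u1]; rewrite /digit; case: pselect => [e|]; last first.
  by case; exact: cumul_sup.
case: ex_minnP => m um mm; split=> [<-|/andP[ku uk]].
  rewrite um andbT; case: m mm {um} => [|m] mm.
    by rewrite /cumul big_geq.
  by rewrite leNgt; apply/negP => /mm; rewrite ltnn.
apply/eqP; rewrite eqn_leq mm//= leqNgt; apply/negP => mk.
by have := lt_le_trans um (le_trans (cumul_nd mk) ku); rewrite ltxx.
Qed.

(** The left end and the length of the interval of points with first digits s. *)
Fixpoint lo (s : seq nat) : R :=
  if s is k :: s' then cumul k + q k * lo s' else 0.

Definition len (s : seq nat) : R := \prod_(k <- s) q k.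

Lemma len_ge0 s : 0 <= len s.
Proof. exact: prodr_ge0. Qed.

Lemma lo_bounds s : 0 <= lo s /\ lo s + len s <= 1.
Proof.
elim: s => [|k s [IH0 IH1]] /=; first by rewrite /len big_nil add0r.
split; first by rewrite addr_ge0 ?cumul_ge0// mulr_ge0.
rewrite /len big_cons -/(len s) -addrA -mulrDr.
apply: le_trans (cumul_le1 k.+1); rewrite cumulS lerD2l.
by rewrite ler_piMr.
Qed.

Lemma digits_interval s u : 0 <= u < 1 ->
  mkseq (digits u) (size s) = s <-> lo s <= u < lo s + len s.
Proof.
elim: s u => [|k s IH] u u01.
  by rewrite /= /len big_nil add0r u01.
have -> : mkseq (digits u) (size (k :: s)) =
    digit u :: mkseq (digits (rescale u)) (size s).
  rewrite /mkseq /= -[1%N]addn0 iotaDl -map_comp; congr (_ :: _).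
  by apply: eq_map => t; rewrite /= /digits add1n iterSr.
have [lo0 lolen] := lo_bounds s; have len0 := len_ge0 s.
rewrite /len big_cons -/(len s) /= -addrA -mulrDr.
have rescaleE : cumul k <= u < cumul k.+1 -> digit u = k ->
    [/\ 0 < q k, 0 <= rescale u < 1 & u = cumul k + q k * rescale u].
  move=> /andP[ku uk] duk; rewrite /rescale duk.
  have qk : 0 < q k.
    by have := le_lt_trans ku uk; rewrite cumulS ltrDl.
  rewrite divr_ge0 ?subr_ge0//= ltr_pdivrMr// mul1r ltrBlDl -cumulS uk.
  by split=> //; rewrite mulrCA divff ?gt_eqF// mulr1; lra.
split=> [[duk ms]|/andP[kl ku]].
  have ku := (digitE k u01).1 duk; have [qk r01 ->] := rescaleE ku duk.
  have /andP[lr rl] := (IH _ r01).1 ms.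
  by rewrite lerD2l ltrD2l ler_pM2l// ltr_pM2l// lr rl.
have kuk : cumul k <= u < cumul k.+1.
  apply/andP; split; first by apply: le_trans kl; rewrite lerDl mulr_ge0.
  apply: (lt_le_trans ku); rewrite cumulS lerD2l ler_piMr//.
have duk := (digitE k u01).2 kuk.
rewrite duk; congr (_ :: _).
have [qk r01 uE] := rescaleE kuk duk.
rewrite uE lerD2l ler_pM2l// in kl; rewrite uE ltrD2l ltr_pM2l// in ku.
by apply: (IH _ r01).2; rewrite kl ku.
Qed.

End digits.

(** Group elements are encoded as digits by an injection c into nat;
    digits outside the range of c have weight zero and do not occur. *)
Section digit_paths.
Context (R : realType) (G : groupType) (q : nat -> R) (c : G -> nat).
Hypothesis q0 : forall k, 0 <= q k.
Hypothesis q1 : (\sum_(0 <= k <oo) (q k)%:E = 1)%E.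
Hypothesis ci : injective c.
Hypothesis qc : forall k, 0 < q k -> exists x, c x = k.

Definition decode (k : nat) : G :=
  if pselect (exists x, c x = k) is left e then projT1 (cid e) else 1%g.

Lemma decodeK x : decode (c x) = x.
Proof.
rewrite /decode; case: pselect => [e|[]]; last by exists x.
by case: cid => y /= /ci.
Qed.

(** The path is made constant outside the unit interval to keep it measurable on
    the whole line. *)
Definition digit_path (u : R) : path_space G :=
  fun t => if 0 <= u < 1 then decode (digits q u t) else 1%g.

Lemma rescale_unit u : 0 <= u < 1 -> 0 <= rescale q u < 1.
Proof.
move=> u01; have /andP[ku uk] := (digitE q0 q1 (digit q u) u01).1 erefl.
have qk : 0 < q (digit q u) by have := le_lt_trans ku uk; rewrite cumulS ltrDl.
by rewrite divr_ge0 ?subr_ge0//= ltr_pdivrMr// mul1r ltrBlDl -cumulS uk.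
Qed.

Lemma decode_digits u t x : 0 <= u < 1 ->
  decode (digits q u t) = x <-> digits q u t = c x.
Proof.
move=> u01; split=> [<-|->]; last exact: decodeK.
have r01 : 0 <= iter t (rescale q) u < 1.
  by elim: t => // t IH; rewrite iterS rescale_unit.
have /andP[ku uk] := (digitE q0 q1 (digits q u t) r01).1 erefl.
have [|y ycy] := qc (k := digits q u t).
  by have := le_lt_trans ku uk; rewrite cumulS ltrDl.
by rewrite -ycy decodeK.
Qed.

Lemma digit_path_cyl s :
  `[0%R, 1%R[ `&` digit_path @^-1` cyl s =
  `[lo q (map c s), lo q (map c s) + len q (map c s)[%classic :> set R.
Proof.
have [lo0 lolen] := lo_bounds q0 q1 (map c s).
apply/seteqP; split=> u /=; rewrite !in_itv /=.
  move=> [u01 us]; apply: (digits_interval q0 q1 _ u01).1; rewrite size_map.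
  apply: (@eq_from_nth _ 0%N); rewrite size_mkseq ?size_map// => i ilt.
  rewrite nth_mkseq// (nth_map 1%g)//; apply/(decode_digits _ _ u01).
  have := congr1 (nth 1%g ^~ i) us.
  by rewrite nth_mkseq// /digit_path u01.
move=> /andP[lu ul]; have u01 : 0 <= u < 1.
  by rewrite (le_trans lo0 lu) (lt_le_trans ul lolen).
split=> //; rewrite /cyl /=.
have := (digits_interval q0 q1 (map c s) u01).2; rewrite lu ul => /(_ isT).
rewrite size_map => us.
apply: (@eq_from_nth _ 1%g); rewrite size_mkseq// => i ilt.
rewrite nth_mkseq// /digit_path u01; apply/(decode_digits _ _ u01).
have := congr1 (nth 0%N ^~ i) us.
by rewrite nth_mkseq// (nth_map 1%g).
Qed.

Lemma measurable_digit_path : countable [set: G] ->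
  measurable_fun setT digit_path.
Proof.
move=> cG; apply: measurable_fun_cyl => // s.
have mI : measurable (`[0%R, 1%R[%classic : set R) by exact: measurable_itv.
rewrite -(setUIDK (digit_path @^-1` cyl s) `[0%R, 1%R[%classic).
apply: measurableU; first by rewrite setIC digit_path_cyl; exact: measurable_itv.
have [s1|s1] := pselect (cyl s (fun=> 1%g)).
  rewrite (_ : _ `\` _ = ~` `[0%R, 1%R[%classic); first exact: measurableC.
  apply/seteqP; split=> u /=; rewrite in_itv/=; first by case.
  move=> nu; split=> //; rewrite (_ : digit_path u = (fun=> 1%g))//.
  by apply/funext => t; rewrite /digit_path (negbTE (introN idP nu)).
rewrite (_ : _ `\` _ = set0); first exact: measurable0.
apply/seteqP; split=> // u /=; rewrite in_itv/= => -[us nu]; apply: s1.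
move: us; rewrite (_ : digit_path u = (fun=> 1%g))//.
by apply/funext => t; rewrite /digit_path (negbTE (introN idP nu)).
Qed.

End digit_paths.

(** The law of the base-q digits of a uniform point of the unit interval: the
    points whose first digits are prescribed form an interval whose length is
    the product of the corresponding weights. *)
Lemma iid_law_exists (R : realType) (G : groupType) (p : G -> R) :
  countable [set: G] -> (forall x, 0 <= p x) ->
  (\esum_(x in [set: G]) (p x)%:E = 1)%E ->
  exists Q : probability (path_space G) R, iid_law p Q.
Proof.
move=> cG p0 p1; have /countable_injP[c ci'] := cG.
have ci : injective c by move=> x y; apply: ci'; rewrite inE.
pose q k := if k \in c @` [set: G] then p (decode c k) else 0.
have q0 k : 0 <= q k by rewrite /q; case: ifP.
have qc k : 0 < q k -> exists x, c x = k.
  by rewrite /q; case: ifPn => [|_]; rewrite ?ltxx// inE => -[x _ <-]; exists x.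
have qcE x : q (c x) = p x.
  by rewrite /q mem_set ?decodeK//; exists x.
have q1 : (\sum_(0 <= k <oo) (q k)%:E = 1)%E.
  rewrite nneseries_esumT; last by move=> k; rewrite lee_fin.
  rewrite -p1; transitivity (\esum_(k in c @` [set: G]) (q k)%:E)%E.
    rewrite [RHS]esum_mkcond; apply: eq_esum => k _.
    by rewrite /q; case: ifP.
  rewrite esum_image; first by apply: eq_esum => x _; rewrite qcE.
  by move=> x y _ _; exact: ci.
have mD := measurable_digit_path q0 q1 ci qc cG.
have mI : measurable (`[0%R, 1%R[%classic : set R) by exact: measurable_itv.
pose m := measure_function_pushforward__canonical__measure_function_Measure
  (mrestr (@lebesgue_measure R) mI) mD.
have mcyl s : m (cyl s) = (\prod_(x <- s) p x)%:E.
  rewrite /m /= /pushforward /mrestr setIC digit_path_cyl//.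
  rewrite lebesgue_measure_itv /= lte_fin ltrDl.
  have -> : len q (map c s) = \prod_(x <- s) p x.
    by rewrite /len big_map; apply: eq_bigr => x _.
  case: ifPn => [_|]; first by rewrite -EFinB addrAC subrr add0r.
  rewrite -leNgt => le0; congr (_%:E); apply/eqP.
  by rewrite eq_le le0 prodr_ge0.
have m1 : m setT = 1%E by rewrite -cyl_nil mcyl big_nil.
(* The normalization leaves m, of mass 1, as it is; it turns it into a
   probability, with the Dirac mass as its fallback for degenerate measures. *)
exists (mnormalize m (dirac ((fun=> 1%g) : path_space G))) => n x.
have -> : [set h | forall t, (t < n)%N -> h t = x t] = cyl (mkseq x n).
  apply/seteqP; split=> h /=; rewrite /cyl /= -/(mkseq x n) size_mkseq.
    by move=> hx; apply/mkseq_eqP.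
  by move/mkseq_eqP.
rewrite /= /mnormalize m1 /= onee_eq0 /= invr1 mule1 [LHS]mcyl; congr (_%:E).
rewrite (big_nth 1%g) size_mkseq big_mkord.
by apply: eq_bigr => i _; rewrite nth_mkseq.
Qed.

(** * The lamplighter group and the levels of the step distribution *)

Lemma Z2_neq0 (x : 'Z_2) : x != 0 -> x = 1.
Proof. by case: x => -[|[|k]] i // _; exact/val_inj. Qed.

Lemma countable_lamplighter : countable [set: lamplighter].
Proof.
apply/countable_injP.
exists (fun g : lamplighter => choice.pickle (g.1, finsupp g.2)).
move=> [n phi] [m psi] _ _ /(pcan_inj choice.pickleK) /= [-> fphi].
congr pair; apply: configP => z.
have [zphi|zphi] := boolP (z \in finsupp phi); last first.
  by rewrite !fsfun_dflt// -fphi.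
have zpsi : z \in finsupp psi by rewrite -fphi.
by move: zphi zpsi; rewrite !mem_finsupp => /Z2_neq0 -> /Z2_neq0 ->.
Qed.

Lemma config_bound (phi : config) : exists m : nat, forall z, phi z != 0 -> z <= m%:Z.
Proof.
exists (\max_(z <- finsupp phi) `|z|)%N => z; rewrite -mem_finsupp => zphi.
have : (`|z| <= \max_(z <- finsupp phi) `|z|)%N.
  exact: (@leq_bigmax_seq _ _ xpredT (fun z : int => `|z|%N)).
by lia.
Qed.

Definition lamp (n : int) (phi : config) : lamplighter := (n, phi).

Lemma lampME (g h : lamplighter) :
  (g * h)%g = (g.1 + h.1, g.2 + config_shift g.1 h.2) :> lamplighter.
Proof. by []. Qed.

Lemma lamp_sqr (delta : config) :
  (lamp 0 delta * lamp 0 delta = 1 :> lamplighter)%g.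
Proof.
rewrite lampME /= config_shift0 addr0; congr lamp.
(* Opposites in config are the identity, so that this is - delta + delta = 0. *)
exact: (addNr delta).
Qed.

Lemma lamp_conj (delta : config) (g : lamplighter) :
  (lamp 0 delta ^ g = lamp 0 (config_shift (- g.1) delta) :> lamplighter)%g.
Proof.
rewrite conjgE; suff -> : (lamp 0 delta * g =
    g * lamp 0 (config_shift (- g.1) delta) :> lamplighter)%g.
  by rewrite mulKg.
rewrite !lampME /= config_shift0 config_shift_shift subrr config_shift0.
by rewrite addr0 add0r [delta + _]addrC.
Qed.

Lemma lamp_div (n : int) (phi psi : config) :
  (lamp n phi * (lamp n psi)^-1 = lamp 0 (phi - psi) :> lamplighter)%g.
Proof.
suff -> : (lamp n phi = lamp 0 (phi - psi) * lamp n psi :> lamplighter)%g.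
  by rewrite mulgK.
by rewrite lampME /= config_shift0 add0r subrK.
Qed.

Lemma K_supp n phi z : K n phi -> phi z != 0 -> 0 <= z <= n%:Z.
Proof. by move=> [sphi _] /Z2_neq0 /sphi. Qed.

Lemma K_uniq m n phi : K m phi -> K n phi -> m = n.
Proof.
move=> Km Kn.
have n1 k : K k phi -> phi k%:Z != 0 by case=> _ ->.
by have := K_supp Km (n1 _ Kn); have := K_supp Kn (n1 _ Km); lia.
Qed.

(** A configuration supported strictly below n only acts on the sites where the
    uniform measure on K n is a product of fair coins. *)
Lemma K_add n (phi delta : config) : (forall z, delta z != 0 -> 0 <= z < n%:Z) ->
  K n phi -> K n (delta + phi).
Proof.
move=> sdelta Kn; split=> [z|].
  rewrite configDE => z1; have [dz|dz] := eqVneq (delta z) 0.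
    by rewrite dz add0r in z1; have [sphi _] := Kn; exact: sphi.
  by have := sdelta z dz; lia.
rewrite configDE; have [_ ->] := Kn.
have [->|dn] := eqVneq (delta n%:Z) 0; first by rewrite add0r.
by have := sdelta _ dn; rewrite ltxx andbF.
Qed.

Lemma kappaE (R : realType) n phi :
  kappa R n phi = (phi \in K n)%:R / (2 ^ n)%:R.
Proof. by rewrite /kappa /unif indicE (card_K n).2. Qed.

Lemma lambda_K (R : realType) (alpha : nat -> R) n phi :
  (0 < n)%N -> K n phi -> lambda alpha phi = alpha n / (2 ^ n)%:R.
Proof.
move=> n0 Kn; rewrite /lambda; apply: (@lim_near_cst R) => //.
near=> k; have nk : (n < k)%N by near: k; exact: nbhs_infty_gt.
rewrite (bigD1_seq n)/= ?mem_index_iota ?n0 ?nk ?iota_uniq// big1_seq ?addr0.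
  by rewrite kappaE mem_set// mul1r.
move=> m /andP[mn _]; rewrite kappaE memNset ?mul0r ?mulr0// => Km.
by rewrite (K_uniq Km Kn) eqxx in mn.
Unshelve. all: by end_near. Qed.

Lemma lambda_notK (R : realType) (alpha : nat -> R) phi :
  (forall n, (0 < n)%N -> ~ K n phi) -> lambda alpha phi = 0.
Proof.
move=> nK; rewrite /lambda; apply: (@lim_near_cst R) => //; near=> k.
rewrite big_nat_cond big1// => n /andP[/andP[n0 _] _].
by rewrite kappaE memNset ?mul0r ?mulr0//; exact: nK.
Unshelve. all: by end_near. Qed.

(** Levels are indexed from 0 for the sake of series, hence the shift in K n.+1. *)
Definition step_level (n : nat) : set lamplighter :=
  [set g | g.1 = -1 /\ K n.+1 g.2].

Lemma mu_level (R : realType) (alpha : nat -> R) n g :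
  step_level n g -> mu_of alpha g = alpha n.+1 / (2 ^ n.+1)%:R.
Proof. by move=> [g1 Kg]; rewrite /mu_of g1 eqxx mul1r (lambda_K _ _ Kg). Qed.

Lemma mu_notlevel (R : realType) (alpha : nat -> R) g :
  (forall n, ~ step_level n g) -> mu_of alpha g = 0.
Proof.
move=> ng; rewrite /mu_of; have [g1|] := eqVneq g.1 (-1); last by rewrite mul0r.
by rewrite lambda_notK ?mulr0// => -[//|n] _ Kg; apply: (ng n).
Qed.

(** This is why the coupling succeeds: on a level above n the measure does not
    see a change of the lamps at the sites 0 to n. *)
Lemma mu_twist (R : realType) (alpha : nat -> R) n (delta : config) g :
  (forall z, delta z != 0 -> 0 <= z <= n%:Z) -> step_level n g ->
  mu_of alpha (lamp 0 delta * g)%g = mu_of alpha g.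
Proof.
move=> sd lg; rewrite (mu_level _ lg); apply: mu_level.
case: lg => g1 Kg; rewrite lampME; split=> /=; first by rewrite add0r.
rewrite config_shift0; apply: K_add => // z /sd; lia.
Qed.

Lemma esum_level_cst (n : nat) (R : realType) (v : R) : 0 <= v ->
  (\esum_(g in step_level n) v%:E = ((2 ^ n.+1)%:R * v)%:E)%E.
Proof.
move=> v0; have [finK cardK] := card_K n.+1.
rewrite (_ : step_level n = lamp (-1) @` K n.+1).
  rewrite esum_image; last by move=> x y _ _ [].
  rewrite esum_fset//.
  rewrite fsbig_finite//= sumEFin big_const_seq iter_addr addr0.
  by rewrite count_predT cardK mulr_natl.
apply/seteqP; split=> [[k phi] [/= k1 Kphi]|_ /= [phi Kphi <-]//].
by exists phi; rewrite // k1.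
Qed.

Lemma step_level_uniq m n g : step_level m g -> step_level n g -> m = n.
Proof. by move=> [_ Km] [_ Kn]; have [] := K_uniq Km Kn. Qed.

(** A level carries 2 ^ n.+1 elements and mu is constant on it, which turns sums
    over the group into series. *)
Lemma esum_levels (R : realType) (f : lamplighter -> R) (v : nat -> R) :
  (forall n, 0 <= v n) -> (forall n g, step_level n g -> f g = v n) ->
  (forall g, (forall n, ~ step_level n g) -> f g = 0) ->
  (\esum_(g in [set: lamplighter]) (f g)%:E =
    \sum_(0 <= n <oo) ((2 ^ n.+1)%:R * v n)%:E)%E.
Proof.
move=> v0 fv f0.
have fge0 g : 0 <= f g.
  have [[n ng]|ng] := pselect (exists n, step_level n g); first by rewrite (fv n).
  by rewrite f0// => n ng'; apply: ng; exists n.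
transitivity (\esum_(g in \bigcup_n step_level n) (f g)%:E)%E.
  rewrite [RHS]esum_mkcond; apply: eq_esum => g _; case: ifPn => //.
  rewrite notin_setE => ng; rewrite f0// => n lg; apply: ng.
  by exists n.
rewrite nneseries_sum_bigcup//; last first.
  apply/trivIsetP => m n _ _ /eqP mn; apply/seteqP; split=> // g [gm gn].
  by apply: mn; exact: step_level_uniq gm gn.
apply: eq_eseriesr => n _; rewrite -esum_level_cst//.
by apply: eq_esum => g /fv ->.
Qed.

(** * Infinite entropy and the mean level *)

(** Fenchel's inequality for x ln x; it rests on 1 + t <= exp t at the point
    t = - y - ln x. *)
Lemma entropy_le (R : realType) (x y : R) : 0 <= x ->
  - (x * ln x) <= x * y + expR (- y).
Proof.
rewrite le_eqVlt => /predU1P[<-|x0].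
  by rewrite !mul0r oppr0 add0r expR_ge0.
have := expR_ge1Dx (- y - ln x); rewrite expRD [expR (- ln x)]expRN lnK ?posrE//.
by rewrite -(ler_pM2r x0) divfK ?gt_eqF//; lra.
Qed.

Lemma expR_le_pow4 (R : realType) (m : nat) :
  expR (- (m%:R * 2) : R) <= ((4 ^ m)%:R)^-1.
Proof.
have p4 : 0 < (4 ^ m)%:R :> R by rewrite ltr0n expn_gt0.
rewrite expRN lef_pV2 ?posrE ?expR_gt0//.
rewrite expRM_natl natrX lerXn2r ?nnegrE ?expR_ge0 ?ler0n//.
have e1 := expR_ge1Dx (1 : R).
have -> : (2 : R) = 1 + 1 by lra.
rewrite expRD; nra.
Qed.

Section weights.
Context (R : realType) (alpha : nat -> R).
Hypothesis alpha_ge0 : forall n : nat, (1 <= n)%N -> 0 <= alpha n.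
Hypothesis alpha_sum1 : (\sum_(1 <= n <oo) (alpha n)%:E = 1)%E.

Let a n := alpha n.+1.

Lemma alphaS_ge0 n : 0 <= a n.
Proof. exact: alpha_ge0. Qed.

Lemma alphaS_sum1 : (\sum_(0 <= n <oo) (a n)%:E = 1)%E.
Proof.
rewrite -alpha_sum1 /a.
pose f n := if n is 0%N then 0 else alpha n.
transitivity (\sum_(0 <= n <oo) (f (n + 1)%N)%:E)%E.
  by apply: eq_eseriesr => n _; rewrite addn1.
rewrite (@nneseries_addn _ (fun n => (f n)%:E)) => [|[|n]]; last 2 first.
- by rewrite lee_fin.
- by rewrite lee_fin alpha_ge0.
by apply/congr_lim/funext => n; apply: eq_big_nat => -[].
Qed.

Lemma alphaS_le1 n : a n <= 1.
Proof.
rewrite -lee_fin -alphaS_sum1 (@nneseriesD1 _ (fun k => (a k)%:E) n xpredT)//; last first.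
  by move=> k _; rewrite lee_fin alphaS_ge0.
by rewrite leeDl// nneseries_ge0// => k _ _; rewrite lee_fin alphaS_ge0.
Qed.

Lemma pow2_gt0 m : 0 < (2 ^ m)%:R :> R.
Proof. by rewrite ltr0n expn_gt0. Qed.

Lemma level_weight_ge0 n : 0 <= a n / (2 ^ n.+1)%:R.
Proof. by rewrite divr_ge0 ?alphaS_ge0 ?ltW ?pow2_gt0. Qed.

Lemma esum_mu : (\esum_(g in [set: lamplighter]) (mu_of alpha g)%:E = 1)%E.
Proof.
rewrite (@esum_levels _ _ (fun n => a n / (2 ^ n.+1)%:R)).
- rewrite -alphaS_sum1; apply: eq_eseriesr => n _.
  by rewrite mulrCA divff ?mulr1// gt_eqF// pow2_gt0.
- exact: level_weight_ge0.
- by move=> n g /mu_level ->.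
- exact: mu_notlevel.
Qed.

(** The mass of a single element of the level with index n is b n. By Fenchel's
    inequality its entropy is at most 2 (n+1) (b n) up to an error exp (-2 (n+1)),
    which is at most 4 ^ -(n+1). Summing over the 2 ^ (n+1) elements of the level
    and over n bounds the entropy by twice the mean level plus 1. *)
Lemma mean_infinite : entropy (mu_of alpha) = +oo%E ->
  (\sum_(0 <= n <oo) (n.+1%:R * a n)%:E = +oo)%E.
Proof.
move=> Hoo; set S := (\sum_(0 <= n <oo) _)%E.
have ma0 n : (0 <= (n.+1%:R * a n)%:E)%E by rewrite lee_fin mulr_ge0 ?alphaS_ge0.
suff : (entropy (mu_of alpha) <= 2%:E * S + 1)%E.
  rewrite Hoo leye_eq; case: S => [r /eqP//|//|].
  by rewrite mulrNy gtr0_sg// mul1e.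
pose b n := a n / (2 ^ n.+1)%:R.
have v0 n : 0 <= - (b n * ln (b n)).
  rewrite oppr_ge0 mulr_ge0_le0 ?level_weight_ge0// ln_le0// ler_pdivrMr ?pow2_gt0//.
  by rewrite mul1r (le_trans (alphaS_le1 n))// ler1n expn_gt0.
rewrite /entropy (@esum_levels _ _ (fun n => - (b n * ln (b n)))); last 3 first.
- exact: v0.
- by move=> n g /mu_level ->.
- by move=> g /mu_notlevel ->; rewrite mul0r oppr0.
rewrite /S -nneseriesZl//.
apply: le_trans (epsilon_trick xpredT _ ler01); last first.
  by move=> n; rewrite mule_ge0.
apply: lee_nneseries => [n _ _|n _].
  by rewrite lee_fin mulr_ge0.
rewrite -EFinM -EFinD lee_fin.
have bE : (2 ^ n.+1)%:R * b n = a n.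
  by rewrite mulrCA divff ?mulr1// gt_eqF// pow2_gt0.
have := entropy_le (n.+1%:R * 2) (level_weight_ge0 n); rewrite -/(b n) => le.
apply: (@le_trans _ _ ((2 ^ n.+1)%:R * (b n * (n.+1%:R * 2) + (4 ^ n.+1)%:R^-1))).
  rewrite ler_pM2l ?pow2_gt0//; apply: (le_trans le).
  by rewrite lerD2l expR_le_pow4.
rewrite mulrDr mulrA bE; apply: lerD; first by rewrite mulrC -mulrA mulrCA.
rewrite (_ : 4 = 2 * 2)%N// expnMn natrM invfM mulrA divff ?gt_eqF ?pow2_gt0//.
Qed.

End weights.

(** * High levels occur infinitely often *)

(** The tail-sum formula for the expectation of a random index with weights a. *)
Lemma sum_tails (R : realType) (a : nat -> R) : (forall n, 0 <= a n) ->
  (\sum_(0 <= k <oo) \sum_(k <= n <oo) (a n)%:E =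
   \sum_(0 <= n <oo) (n.+1%:R * a n)%:E)%E.
Proof.
move=> a0.
transitivity (\sum_(0 <= k <oo) \sum_(0 <= n <oo) (if (k <= n)%N then (a n)%:E else 0))%E.
  apply: eq_eseriesr => k _; rewrite eseries_cond eseries_mkcond.
  by apply: eq_eseriesr => n _.
rewrite nneseries_interchange; last by move=> k n; case: ifP; rewrite ?lee_fin.
apply: eq_eseriesr => n _.
rewrite (nneseries_split _ n.+1) => [|k _]; last by case: ifP; rewrite ?lee_fin.
rewrite add0n [X in (_ + X)%E]eseries0 ?adde0 => [|k nk _]; last first.
  by rewrite leqNgt nk.
rewrite (eq_big_nat _ _ (F2 := fun=> (a n)%:E)) => [|k /andP[_ kn]]; last first.
  by rewrite -ltnS kn.
rewrite sumEFin big_const_nat subn0 iter_addr addr0 mulr_natl//.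
Qed.

(** Dropping the first c tails, each of which is at most 1, keeps the sum
    infinite. *)
Lemma tail_sums_infinite (R : realType) (a : nat -> R) c : (forall n, 0 <= a n) ->
  (\sum_(0 <= n <oo) (a n)%:E = 1)%E ->
  (\sum_(0 <= n <oo) (n.+1%:R * a n)%:E = +oo)%E ->
  (\sum_(0 <= k <oo) \sum_(k + c <= n <oo) (a n)%:E = +oo)%E.
Proof.
move=> a0 a1; rewrite -sum_tails//.
set f := fun k => (\sum_(k <= n <oo) (a n)%:E)%E.
have f0 k : (0 <= f k)%E by apply: nneseries_ge0 => n _ _; rewrite lee_fin.
have f1 k : (f k <= 1)%E.
  rewrite -a1 (nneseries_split _ k) => [|n _]; last by rewrite lee_fin.
  by rewrite add0n leeDr// sume_ge0// => n _; rewrite lee_fin.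
rewrite (@nneseries_split _ f 0 c) => [|k _]; last exact: f0.
rewrite add0n -nneseries_addn// => soo.
have fin : (\sum_(0 <= k < c) f k)%E \is a fin_num.
  apply/sum_fin_numP => k _ _; rewrite ge0_fin_numE//.
  exact: le_lt_trans (f1 k) (ltry 1).
apply/eqP; move/eqP: soo; rewrite -[X in (X + _)%E]fineK//.
by case: (X in (_ + X)%E) => [r||].
Qed.

Section level_law.
Context (R : realType) (alpha : nat -> R).
Hypothesis alpha_ge0 : forall n : nat, (1 <= n)%N -> 0 <= alpha n.
Hypothesis alpha_sum1 : (\sum_(1 <= n <oo) (alpha n)%:E = 1)%E.
Context (Q : probability (path_space lamplighter) R).
Hypothesis iidQ : iid_law (mu_of alpha) Q.

Let head (h : path_space lamplighter) := h 0%N.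

Lemma measurable_head E : measurable (head @^-1` E).
Proof. exact: (measurable_coord_preimage countable_lamplighter 0%N). Qed.

Lemma finite_step_level n : finite_set (step_level n).
Proof.
apply: (@sub_finite_set _ _ (lamp (-1) @` K n.+1)).
  by move=> [k phi] [/= -> Kphi]; exists phi.
by apply: finite_image; have [] := card_K n.+1.
Qed.

Lemma level_prob n : Q (head @^-1` step_level n) = (alpha n.+1)%:E.
Proof.
have -> : head @^-1` step_level n =
    \bigcup_(x in step_level n) [set h : path_space lamplighter | h 0%N = x].
  apply/seteqP; split=> h /=; first by exists (h 0%N).
  by move=> [x lx /= hx]; rewrite /head hx.
rewrite measure_fin_bigcup; last 3 first.
- exact: finite_step_level.
- by apply/trivIsetP => x y _ _ /eqP xy; apply/seteqP; split=> // h /= [hx hy];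
    apply: xy; rewrite -hx.
- by move=> x _; exact: measurable_coord.
rewrite -esum_fset; last 2 first.
- exact: finite_step_level.
- by move=> x _; exact: measure_ge0.
rewrite (eq_esum (b := fun=> (alpha n.+1 / (2 ^ n.+1)%:R)%:E)) => [|x lx]; last first.
  rewrite -(mu_level alpha lx).
  exact: (iid_singleton countable_lamplighter iidQ 0 x).
by rewrite esum_level_cst ?level_weight_ge0// mulrCA divff ?mulr1// gt_eqF// pow2_gt0.
Qed.

Definition levels_from (k : nat) : set lamplighter :=
  [set g | exists2 n, (k <= n)%N & step_level n g].

Lemma levels_from_prob k :
  Q (head @^-1` levels_from k) = (\sum_(k <= n <oo) (alpha n.+1)%:E)%E.
Proof.
have -> : head @^-1` levels_from k =
    \bigcup_(n in [set n | (k <= n)%N]) (head @^-1` step_level n).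
  by apply/seteqP; split=> h /= [n]; exists n.
rewrite measure_bigcup; last 2 first.
- by move=> n _; exact: measurable_head.
- apply/trivIsetP => m n _ _ /eqP mn; apply/seteqP; split=> // h [hm hn].
  by apply: mn; exact: step_level_uniq hm hn.
rewrite [RHS]eseries_cond [LHS](eq_eseriesr (g := fun n => (alpha n.+1)%:E)).
  by apply: eq_eseriesl => n; apply/idP/idP; rewrite ?inE.
by move=> n _; exact: level_prob.
Qed.

Hypothesis mean_oo : (\sum_(0 <= n <oo) (n.+1%:R * alpha n.+1)%:E = +oo)%E.

(** The second Borel-Cantelli lemma: the probability of avoiding the first n of
    these independent events is at most exp of minus the sum of their
    probabilities. *)
Lemma levels_from_often c :
  Q.-negligible [set h | forall i, ~ levels_from (i + c) (h i)].
Proof.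
set p := fun i => fine (\sum_(i + c <= n <oo) (alpha n.+1)%:E)%E.
have pE i : Q (head @^-1` levels_from (i + c)) = (p i)%:E.
  rewrite /p -levels_from_prob fineK// fin_num_measure//; exact: measurable_head.
have poo : (\sum_(0 <= i <oo) (p i)%:E = +oo)%E.
  rewrite -(@tail_sums_infinite _ (fun n => alpha n.+1) c)//.
  - by apply: eq_eseriesr => i _; rewrite -pE levels_from_prob.
  - by move=> n; exact: alpha_ge0.
  - exact: alphaS_sum1.
pose X := [set h : path_space lamplighter | forall i, ~ levels_from (i + c) (h i)].
have mX : measurable X.
  rewrite (_ : X = \bigcap_i (fun h => h i) @^-1` (~` levels_from (i + c))).
    apply: bigcap_measurableType => i _.
    exact: (measurable_coord_preimage countable_lamplighter i).
  by apply/seteqP; split=> h /= hi i => [_|]; exact: hi.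
apply/negligibleP => //.
have QX n : (Q X <= (expR (- \sum_(0 <= i < n) p i))%:E)%E.
  pose Y := [set h : path_space lamplighter |
    forall i, (i < n)%N -> (~` levels_from (i + c)) (h i)].
  have mY : measurable Y.
    rewrite (_ : Y = \bigcap_(i in `I_n) (fun h => h i) @^-1` (~` levels_from (i + c)))//.
    apply: bigcap_measurableType => i _.
    exact: (measurable_coord_preimage countable_lamplighter i).
  apply: (@le_trans _ _ (Q Y)).
    by apply: le_measure; rewrite ?inE// => h hX i _; exact: hX.
  rewrite [leLHS](iid_forall countable_lamplighter iidQ n
    (fun i => ~` levels_from (i + c))).
  rewrite (eq_bigr (fun i : 'I_n => (1 - p i)%:E)) => [|i _]; last first.
    rewrite -(preimage_setC) probability_setC; last exact: measurable_head.
    by rewrite pE -EFinB.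
  rewrite prodEFin lee_fin -sumrN expR_sum big_mkord.
  apply: ler_prod => i _; rewrite expR_ge1Dx andbT -lee_fin EFinB -pE.
  by rewrite sube_ge0 ?fin_num_measure ?probability_le1//; exact: measurable_head.
apply/eqP; rewrite eq_le measure_ge0 andbT leNgt; apply/negP => QX0.
have QXf : Q X \is a fin_num by rewrite fin_num_measure.
have x0 : 0 < fine (Q X) by rewrite fine_gt0// QX0 ltey_eq QXf.
(* A positive probability x would bound all partial sums by - ln x. *)
suff : (\sum_(0 <= i <oo) (p i)%:E <= (- ln (fine (Q X)))%:E)%E by rewrite poo.
apply: lime_le.
  by apply: is_cvg_nneseries => i _ _; rewrite -pE.
apply: nearW => n; rewrite sumEFin lee_fin -[leLHS]opprK lerN2.
by rewrite -[leRHS]expRK ler_ln ?posrE ?expR_gt0// -lee_fin fineK.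
Qed.

End level_law.

(** * The two walks *)

Lemma iid_drop_negligible (R : realType) (G : groupType) (mu : G -> R)
    (Q : probability (path_space G) R) n (N : set (path_space G)) :
  countable [set: G] -> iid_law mu Q -> Q.-negligible N ->
  Q.-negligible (drop_path n @^-1` N).
Proof.
move=> cG iidQ [M [mM M0 NM]]; exists (drop_path n @^-1` M); split.
- exact: measurable_drop_preimage.
- by rewrite (iid_drop cG iidQ).
- by move=> h /NM.
Qed.

Lemma mu_neq0_level (R : realType) (alpha : nat -> R) g :
  mu_of alpha g <> 0 -> exists n, step_level n g.
Proof.
move=> mu0; apply: contrapT => ng; apply: mu0; apply: mu_notlevel => n lg.
by apply: ng; exists n.
Qed.

(** After n steps the walk is at - n and has only acted on lamps to the right of
    - n, so that a site where two configurations reached at time n differ lies to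
    the right of every later position. *)
Lemma walk_levels (h : path_space lamplighter) n :
  (forall t, (t < n)%N -> exists m, step_level m (h t)) ->
  (walk h n).1 = - n%:Z /\ forall z, (walk h n).2 z != 0 -> - n%:Z < z.
Proof.
elim: n => [|n IH] lh.
  by rewrite /walk big_ord0; split=> // z; rewrite config_zeroE eqxx.
have [w1 w2] := IH (fun t tn => lh t (ltnW tn)).
have [m [h1 Kh]] := lh n (ltnSn n).
rewrite walkS lampME /= w1 h1; split=> [|z]; first by lia.
rewrite configDE config_shiftE => z0.
have [wz|wz] := eqVneq ((walk h n).2 z) 0; last by have := w2 z wz; lia.
by rewrite wz add0r in z0; have := K_supp Kh z0; lia.
Qed.

Lemma config_sub_neq0 (phi psi : config) z :
  (phi - psi) z != 0 -> phi z != 0 \/ psi z != 0.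
Proof.
rewrite configDE; have [->|] := eqVneq (phi z) 0; last by left.
by rewrite add0r; right.
Qed.

(** Two positions attainable at time n differ by a configuration delta, which is
    an involution of the group. If delta vanishes to the right of m, then at time
    n + i it occupies, seen from the lighter, sites from 0 to m + n + i, and
    the swap is possible as soon as the increment lies on a level beyond. By the
    second Borel-Cantelli lemma this happens almost surely for some i. *)
Lemma liouville_mu (R : realType) (alpha : nat -> R) :
  (forall n : nat, (1 <= n)%N -> 0 <= alpha n) ->
  (\sum_(1 <= n <oo) (alpha n)%:E = 1)%E ->
  (\sum_(0 <= n <oo) (n.+1%:R * alpha n.+1)%:E = +oo)%E ->
  liouville (mu_of alpha).
Proof.
move=> alpha0 alpha1 mean_oo; apply: liouville_swap countable_lamplighter _.
move=> Q iidQ s s0; set n := size s; set g := (\big[*%g/1]_(x <- s) x)%g.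
pose bad c := [set h : path_space lamplighter | forall i, ~ levels_from (i + c) (h i)].
have negl : Q.-negligible ([set h | exists t, mu_of alpha (h t) = 0] `|`
    \bigcup_m (drop_path n @^-1` bad (m + n)%N)).
  apply: negligibleU; first exact: (iid_support countable_lamplighter iidQ).
  apply: negligible_bigcup => m; apply: (iid_drop_negligible _ _ iidQ).
    exact: countable_lamplighter.
  exact: (levels_from_often alpha0 alpha1 iidQ mean_oo).
apply: negligibleS negl => h /= nswap; apply: contrapT => /not_orP[supp good].
have lh t : exists m, step_level m (h t).
  by apply: (@mu_neq0_level _ alpha) => mu0; apply: supp; exists t.
have gE : g = walk (nth 1%g s : path_space lamplighter) n.
  by rewrite walk_mkseq mkseq_nth.
have [g1 g2] : g.1 = - n%:Z /\ forall z, g.2 z != 0 -> - n%:Z < z.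
  rewrite gE; apply: walk_levels => t ts; apply: (@mu_neq0_level _ alpha).
  by apply/eqP; rewrite gt_eqF// s0// mem_nth.
have [w1 w2] := walk_levels (fun t (_ : (t < n)%N) => lh t).
pose delta : config := g.2 - (walk h n).2.
have offE : offset g n h = lamp 0 delta.
  rewrite /offset -(lamp_div (- n%:Z)); congr (_ * _^-1)%g.
    by rewrite /lamp -g1 -surjective_pairing.
  by rewrite /lamp -w1 -surjective_pairing.
have [m dm] := config_bound delta.
have [i li] : exists i, levels_from (i + (m + n)) (h (n + i)%N).
  apply: contrapT => nl; apply: good; exists m => // i li.
  by apply: nl; exists i.
apply: (nswap (n + i)%N); split; first exact: leq_addr.
  by rewrite offE lamp_sqr.
have [wi1 _] := walk_levels (fun t (_ : (t < n + i)%N) => lh t).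
rewrite /twist offE lamp_conj wi1 opprK.
have [k ik lk] := li; apply: (mu_twist alpha _ lk) => z.
rewrite config_shiftE => dz.
have zm := dm _ dz; have [/g2 zn|/w2 zn] := config_sub_neq0 dz; lia.
Qed.

Lemma esum_reflected (R : realType) (G : groupType) (mu : G -> R) :
  (\esum_(g in [set: G]) (reflected mu g)%:E = \esum_(g in [set: G]) (mu g)%:E)%E.
Proof.
rewrite [RHS](reindex_esum [set: G] [set: G] (fun g => g^-1)%g)//.
split=> // [x y _ _|x _]; first exact: invg_inj.
by exists (x^-1)%g => //; rewrite invgK.
Qed.

(** A step of the reflected walk changes lamps to the right of the current
    position only, so that site 1 is out of reach after the first step. *)
Lemma walk_lamp1 (h : path_space lamplighter) t :
  (forall i, exists m, step_level m (h i)^-1%g) ->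
  (walk h t.+1).1 = t.+1%:Z /\ (walk h t.+1).2 1 = (h 0%N).2 1.
Proof.
move=> lh.
have step i : (h i).1 = 1 /\ forall z, (h i).2 z != 0 -> 0 < z.
  have [m [/= h1 Kh]] := lh i; split; first by lia.
  move=> z z0; have := K_supp (z := z - 1) Kh.
  rewrite config_shiftE h1 => /(_ _)/andP[]; last by lia.
  by move: z0; congr (_ != 0); congr ((h i).2 _); lia.
elim: t => [|t [IH1 IH2]].
  by rewrite /walk big_ord1; have [-> _] := step 0%N.
rewrite walkS lampME /= IH1 configDE IH2 config_shiftE.
have [-> s0] := step t.+1; split; first by lia.
have [->|/s0] := eqVneq ((h t.+1).2 (1 - t.+1%:Z)) 0; first by rewrite addr0.
by lia.
Qed.

(** The lamp at 0 is free in K n.+1; both values are needed for the invariant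
    event below to be nontrivial. *)
Lemma level_config (n : nat) (b : bool) : exists phi : config,
  K n.+1 phi /\ (phi 0 == 1) = b.
Proof.
exists [fsfun z in [fset 0; n.+1%:Z]%fset => if z == 0 then b%:R else 1 | 0].
split; last first.
  by rewrite fsfunE !inE eqxx /=; case: b.
split=> [z|]; rewrite fsfunE !inE; last by rewrite eqxx orbT.
by case: eqP => [->//|_]; case: eqP => [->|//] /=; lia.
Qed.

(** The limiting state of the lamp at site 1 is an invariant of the path, and it
    takes both values with positive probability. *)
Lemma not_liouville_reflected (R : realType) (alpha : nat -> R) :
  (forall n : nat, (1 <= n)%N -> 0 <= alpha n) ->
  (\sum_(1 <= n <oo) (alpha n)%:E = 1)%E ->
  ~ liouville (reflected (mu_of alpha)).
Proof.
move=> alpha0 alpha1 liou.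
have cG := countable_lamplighter.
have mu0 g : 0 <= mu_of alpha g.
  have [[n lg]|ng] := pselect (exists n, step_level n g).
    by rewrite (mu_level _ lg) level_weight_ge0.
  by rewrite mu_notlevel// => n lg; apply: ng; exists n.
have [Q iidQ] : exists Q : probability (path_space lamplighter) R,
    iid_law (reflected (mu_of alpha)) Q.
  apply: iid_law_exists => //; first by move=> x; exact: mu0.
  by rewrite esum_reflected esum_mu.
pose lamp1 t := [set w : path_space lamplighter | (w t).2 1 = 1].
pose A := \bigcup_n \bigcap_(t in [set t | (n <= t)%N]) lamp1 t.
have mA : measurable A.
  apply: bigcupT_measurable => n; apply: bigcap_measurableType => t _.
  exact: (measurable_coord_preimage cG t [set g : lamplighter | g.2 1 = 1]).
have sA : @time_shift lamplighter @^-1` A = A.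
  apply/seteqP; split=> w [n _ wn].
    exists n.+1 => // -[//|t] /=; rewrite ltnS => nt; exact: wn.
  by exists n => // t nt; apply: (wn t.+1); exact: leqW.
have [N N0] : exists N, 0 < alpha N.+1.
  apply: contrapT => nN; have := alphaS_sum1 alpha0 alpha1.
  rewrite eseries0 => [/eqP|n _ _]; first by rewrite eq_sym onee_eq0.
  congr (_%:E); apply/eqP; rewrite eq_le alpha0// andbT leNgt.
  by apply/negP => an; apply: nN; exists n.
have first_step b : exists g : lamplighter,
    0 < reflected (mu_of alpha) g /\ (g.2 1 == 1) = b.
  have [phi [Kphi phi0]] := level_config N b.
  exists ((lamp (-1) phi)^-1)%g; split.
    rewrite /reflected invgK (@mu_level _ _ N)//.
    by rewrite divr_gt0// pow2_gt0.
  rewrite -phi0 /= config_shiftE; congr (_ == 1).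
have first_prob (g : lamplighter) : Q [set h | h 0%N = g] = (reflected (mu_of alpha) g)%:E.
  exact: (iid_singleton cG iidQ 0 g).
have AE (h : path_space lamplighter) :
    ~ (exists t, reflected (mu_of alpha) (h t) = 0) ->
    (@walk lamplighter @^-1` A) h <-> (h 0%N).2 1 = 1.
  move=> nh; have lh i : exists m, step_level m (h i)^-1%g.
    by apply: (@mu_neq0_level _ alpha) => h0; apply: nh; exists i.
  split=> [[n _ /(_ n.+1 (leqnSn n))]|h1]; rewrite /lamp1 /=.
    by have [_ ->] := walk_lamp1 n lh.
  by exists 1%N => // -[//|t] _ /=; rewrite /lamp1 /=; have [_ ->] := walk_lamp1 t lh.
have mB : measurable (@walk lamplighter @^-1` A : set (path_space lamplighter)).
  by rewrite -[_ @^-1` _]setTI; exact: (measurable_walk cG).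
have negl := iid_support cG iidQ.
have QE : Q (@walk lamplighter @^-1` A) =
    Q ((fun h : path_space lamplighter => h 0%N) @^-1` [set g : lamplighter | g.2 1 = 1]).
  apply: (measure_eq_negligible mB _ negl) => [|h /AE//].
  exact: measurable_coord_preimage.
have mfirst E := @measurable_coord_preimage _ cG 0%N E.
have [[g [g0 /eqP g1]] [g' [g'0 g'1]]] := (first_step true, first_step false).
have [] := liou Q iidQ A mA sA; rewrite QE => Q01.
  have : (Q [set h | h 0%N = g] <= 0)%E.
    rewrite -Q01; apply: le_measure; rewrite ?inE; [exact: measurable_coord|exact: mfirst|].
    by move=> h /= ->.
  by rewrite first_prob lee_fin leNgt g0.
have : (Q [set h | h 0%N = g'] <= 0)%E.
  apply: (@le_trans _ _ (Q (~` ((fun h : path_space lamplighter => h 0%N) @^-1`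
    [set g : lamplighter | g.2 1 = 1])))).
    apply: le_measure; rewrite ?inE.
    - exact: measurable_coord.
    - by apply: measurableC; exact: mfirst.
    by move=> h /= -> /eqP; rewrite g'1.
  by rewrite probability_setC ?Q01 ?subee//; exact: mfirst.
by rewrite first_prob lee_fin leNgt g'0.
Qed.

Theorem theorem52 (R : realType) (alpha : nat -> R)
  (alpha_ge0 : forall n : nat, (1 <= n)%N -> 0 <= alpha n)
  (alpha_sum1 : (\sum_(1 <= n <oo) (alpha n)%:E = 1)%E)
  (H_infinite : entropy (mu_of alpha) = +oo%E) :
  ~ liouville (reflected (mu_of alpha)) /\ liouville (mu_of alpha).
Proof.
split; first exact: not_liouville_reflected.
by apply: liouville_mu => //; exact: mean_infinite.
Qed.
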